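(* Let $(\mathcal{E},\mathbb{E},\mathfrak{s})$ be a Krull–Schmidt extriangulated category and let $\mathcal{W}\subsetneq\mathcal{E}$ be a hereditary-like subcategory. Assume that $\mathcal{E}/\mathcal{W}$ is left locally finite. Then $\mathcal{E}/\mathcal{W}$ is abelian if and only if $\mathcal{W}$ is an $\mathbb{E}_{\mathfrak{e}}$-cluster tilting subcategory in the extriangulated subcategory $(\mathcal{E},\mathbb{E}_{\mathfrak{e}},\mathfrak{s}|_{\mathbb{E}_{\mathfrak{e}}})$.
   Context: An extriangulated category $(\mathcal{E},\mathbb{E},\mathfrak{s})$ is meant in the sense of Nakaoka–Palu: $\mathcal{E}$ is an additive category, $\mathbb{E}:\mathcal{E}^{\mathrm{op}}\times\mathcal{E}\to\mathrm{Ab}$ is an additive bifunctor, and $\mathfrak{s}$ is an additive realization assigning to each $\delta\in\mathbb{E}(C,A)$ an equivalence class $[A\to B\to C]$, subject to the Nakaoka–Palu axioms. If $\mathfrak{s}(\delta)=[A\xrightarrow{x}B\xrightarrow{y}C]$, we write the $\mathbb{E}$-triangle $A\xrightarrow{x}B\xrightarrow{y}C\overset{\delta}{\dashrightarrow}$ ($\delta$ is often omitted). Subcategories are full and closed under isomorphisms. A left $\mathcal{W}$-approximation of $A$ is a morphism $A\to W$ with $W\in\mathcal{W}$ through which every morphism from $A$ to an object of $\mathcal{W}$ factors; a right $\mathcal{W}$-approximation is defined dually. A subcategory $\mathcal{W}\subsetneq\mathcal{E}$ is hereditary-like if: (1) $\mathcal{W}$ is closed under direct sums and direct summands; (2) for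 any $A\in\mathcal{E}$ there is an $\mathbb{E}$-triangle $A\xrightarrow{w^A}W^1\to W^2\dashrightarrow$ with $W^1,W^2\in\mathcal{W}$ and $w^A$ a left $\mathcal{W}$-approximation; (3) for any $A\in\mathcal{E}$ there is an $\mathbb{E}$-triangle $W_2\to W_1\xrightarrow{w_A}A\dashrightarrow$ with $W_1,W_2\in\mathcal{W}$ and $w_A$ a right $\mathcal{W}$-approximation. $\mathcal{E}/\mathcal{W}$ is the additive ideal quotient: same objects, morphisms modulo those factoring through an object of $\mathcal{W}$. A Krull–Schmidt additive category $\mathcal{A}$ is left locally finite if for every indecomposable object $Y$ there are, up to isomorphism, only finitely many indecomposable objects $X$ with $\mathrm{Hom}_{\mathcal{A}}(X,Y)\neq0$. For a subcategory $\mathcal{C}$, a morphism $x:X\to Y$ is $\mathcal{C}$-monic if $\mathrm{Hom}_{\mathcal{E}}(x,C):\mathrm{Hom}_{\mathcal{E}}(Y,C)\to\mathrm{Hom}_{\mathcal{E}}(X,C)$ is surjective for all $C\in\mathcal{C}$; a morphism $y:Y\to Z$ is $\mathcal{C}$-epic if $\mathrm{Hom}_{\mathcal{E}}(C,y)$ is surjective for all $C\in\mathcal{C}$. A morphism $a:A\to B$ is left minimal if every endomorphism $\varphi$ of $B$ with $\varphi a=a$ is an automorphism. ${}_{\mathfrak{e}}\mathcal{W}$ denotes the subcategory of those $W\in\mathcal{W}$ which admit an $\mathbb{E}$-triangle $A\xrightarrow{a}B\to W\dashrightarrow$ with $a$ left minimal and $\mathcal{W}$-monic. $\mathcal{W}\backslash{}_{\mathfrak{e}}\mathcal{W}$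 denotes the additive closure of the objects of $\mathcal{W}$ having no (nonzero) direct summand in ${}_{\mathfrak{e}}\mathcal{W}$. $\mathbb{E}_{\mathfrak{e}}:=\mathbb{E}_{\mathcal{W}\backslash{}_{\mathfrak{e}}\mathcal{W}}\subseteq\mathbb{E}$ is the closed subfunctor for which $\mathbb{E}_{\mathfrak{e}}(Z,X)$ consists of all $\sigma\in\mathbb{E}(Z,X)$ realized by an $\mathbb{E}$-triangle $X\to Y\xrightarrow{y}Z\overset{\sigma}{\dashrightarrow}$ with $y$ being $(\mathcal{W}\backslash{}_{\mathfrak{e}}\mathcal{W})$-epic; $\mathfrak{s}|_{\mathbb{E}_{\mathfrak{e}}}$ is the restriction of $\mathfrak{s}$. The triple $(\mathcal{E},\mathbb{E}_{\mathfrak{e}},\mathfrak{s}|_{\mathbb{E}_{\mathfrak{e}}})$ is again an extriangulated category. For a closed subfunctor $\mathbb{F}\subseteq\mathbb{E}$, a subcategory $\mathcal{M}$ is an $\mathbb{F}$-cluster tilting subcategory of $(\mathcal{E},\mathbb{F},\mathfrak{s}|_{\mathbb{F}})$ if (1) $\mathcal{M}$ is hereditary-like in $(\mathcal{E},\mathbb{F},\mathfrak{s}|_{\mathbb{F}})$ (the definition above with $\mathbb{F}$-triangles in place of $\mathbb{E}$-triangles), and (2) $\mathbb{F}(M,M')=0$ for all $M,M'\in\mathcal{M}$. *)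

(* Defs.v *)
From HB Require Import structures.
From mathcomp Require Import all_boot all_algebra.
From mathcomp Require Import boolp.

Set Implicit Arguments.
Unset Strict Implicit.
Unset Printing Implicit Defensive.

Import GRing.Theory.

Declare Scope cat_scope.
Delimit Scope cat_scope with cat.
Local Open Scope ring_scope.
Local Open Scope cat_scope.

Reserved Notation "g \oc f" (at level 40, left associativity).

Record preaddCat := PreaddCat {
  obj :> Type;
  hom : obj -> obj -> zmodType;
  idm : forall A, hom A A;
  comp : forall A B C, hom B C -> hom A B -> hom A C;
  compA : forall A B C D (h : hom C D) (g : hom B C) (f : hom A B),
    comp h (comp g f) = comp (comp h g) f;
  comp1m : forall A B (f : hom A B), comp (idm B) f = f;
  compm1 : forall A B (f : hom A B), comp f (idm A) = f;
  compDl : forall A B C (g g' : hom B C) (f : hom A B),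
    comp (g + g') f = comp g f + comp g' f;
  compDr : forall A B C (g : hom B C) (f f' : hom A B),
    comp g (f + f') = comp g f + comp g f'
}.

Arguments hom {p} A B.
Arguments idm {p} A.
Arguments comp {p A B C} g f.

Notation "g \oc f" := (comp g f) : cat_scope.

Section Preadditive.
Variable K : preaddCat.
Implicit Types A B C X Y Z : K.

Lemma comp0m A B C (f : hom A B) : (0 : hom B C) \oc f = 0.
Proof. by apply: (addrI (0 \oc f)); rewrite -compDl !addr0. Qed.

Lemma compm0 A B C (g : hom B C) : g \oc (0 : hom A B) = 0.
Proof. by apply: (addrI (g \oc 0)); rewrite -compDr !addr0. Qed.

Lemma compNl A B C (g : hom B C) (f : hom A B) : (- g) \oc f = - (g \oc f).
Proof. by apply: (addrI (g \oc f)); rewrite -compDl !subrr comp0m. Qed.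

Lemma compNr A B C (g : hom B C) (f : hom A B) : g \oc (- f) = - (g \oc f).
Proof. by apply: (addrI (g \oc f)); rewrite -compDr !subrr compm0. Qed.

Definition is_iso A B (f : hom A B) : Prop :=
  exists g : hom B A, g \oc f = idm A /\ f \oc g = idm B.

Definition isomorphic A B : Prop := exists f : hom A B, is_iso f.

Definition is_zero Z : Prop :=
  (forall X (f : hom X Z), f = 0) /\ (forall X (f : hom Z X), f = 0).

Record biprod X Y := Biprod {
  bp_obj :> K;
  bp_inl : hom X bp_obj;
  bp_inr : hom Y bp_obj;
  bp_prl : hom bp_obj X;
  bp_prr : hom bp_obj Y;
  bp_ll : bp_prl \oc bp_inl = idm X;
  bp_rr : bp_prr \oc bp_inr = idm Y;
  bp_lr : bp_prl \oc bp_inr = 0;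
  bp_rl : bp_prr \oc bp_inl = 0;
  bp_id : bp_inl \oc bp_prl + bp_inr \oc bp_prr = idm bp_obj
}.

Definition bp_map X Y X' Y' (S : biprod X Y) (S' : biprod X' Y')
    (f : hom X X') (g : hom Y Y') : hom S S' :=
  bp_inl S' \oc f \oc bp_prl S + bp_inr S' \oc g \oc bp_prr S.

Definition is_direct_sum n (Y : 'I_n -> K) Z : Prop :=
  exists (i : forall k, hom (Y k) Z) (p : forall k, hom Z (Y k)),
    [/\ forall k, p k \oc i k = idm (Y k),
        forall k l, k != l -> p k \oc i l = 0
      & \sum_(k < n) i k \oc p k = idm Z].

Definition is_summand X Z : Prop :=
  exists (Y : K) (S : biprod X Y), isomorphic S Z.

Definition indecomposable X : Prop :=
  ~ is_zero X /\
  forall (Y Z : K) (S : biprod Y Z), isomorphic S X -> is_zero Y \/ is_zero Z.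

(* The ring End(X) is local: it is nonzero and the sum of two nonunits is a
   nonunit. *)
Definition local_End X : Prop :=
  idm X <> 0 /\
  forall f g : hom X X, is_iso (f + g) -> is_iso f \/ is_iso g.

Definition krull_schmidt : Prop :=
  forall X, exists n (Y : 'I_n -> K),
    (forall k, local_End (Y k)) /\ is_direct_sum Y X.

Definition left_locally_finite : Prop :=
  forall Y, indecomposable Y ->
  exists n (L : 'I_n -> K), forall X, indecomposable X ->
    (exists f : hom X Y, f <> 0) -> exists k, isomorphic X (L k).

Definition is_mono A B (f : hom A B) : Prop :=
  forall X (g h : hom X A), f \oc g = f \oc h -> g = h.

Definition is_epi A B (f : hom A B) : Prop :=
  forall X (g h : hom B X), g \oc f = h \oc f -> g = h.

Definition is_kernel A B C (k : hom A B) (f : hom B C) : Prop :=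
  f \oc k = 0 /\
  forall X (g : hom X B), f \oc g = 0 -> exists! u : hom X A, k \oc u = g.

Definition is_cokernel A B C (c : hom B C) (f : hom A B) : Prop :=
  c \oc f = 0 /\
  forall X (g : hom B X), g \oc f = 0 -> exists! u : hom C X, u \oc c = g.

Definition abelian : Prop :=
  [/\ forall A B (f : hom A B), exists (X : K) (k : hom X A), is_kernel k f,
      forall A B (f : hom A B), exists (X : K) (c : hom B X), is_cokernel c f,
      forall A B (f : hom A B), is_mono f ->
        exists (X : K) (g : hom B X), is_kernel f g
    & forall A B (f : hom A B), is_epi f ->
        exists (X : K) (g : hom X A), is_cokernel f g].

Definition left_minimal A B (a : hom A B) : Prop :=
  forall phi : hom B B, phi \oc a = a -> is_iso phi.

(* A full subcategory is given by its class of objects. *)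
Implicit Type W : K -> Prop.

(* As biproducts are only determined up to isomorphism, both closure properties
   below entail closure under isomorphisms. *)
Definition closed_under_sums W : Prop :=
  forall X Y (S : biprod X Y), W X -> W Y -> W S.

Definition closed_under_summands W : Prop :=
  forall X Z, is_summand X Z -> W Z -> W X.

Definition additive_closure W X : Prop :=
  exists n (Y : 'I_n -> K) (Z : K),
    [/\ forall k, W (Y k), is_direct_sum Y Z & is_summand X Z].

Definition Wmonic W X Y (x : hom X Y) : Prop :=
  forall C, W C -> forall f : hom X C, exists g : hom Y C, g \oc x = f.

Definition Wepic W Y Z (y : hom Y Z) : Prop :=
  forall C, W C -> forall f : hom C Z, exists g : hom C Y, y \oc g = f.

Definition left_approx W A B (w : hom A B) : Prop := W B /\ Wmonic W w.

Definition right_approx W A B (w : hom A B) : Prop := W A /\ Wepic W w.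

Definition factors_through W A B (f : hom A B) : Prop :=
  exists C : K, W C /\
  exists (g : hom C B) (h : hom A C), f = g \oc h.

End Preadditive.

Record addCat := AddCat {
  acat :> preaddCat;
  has_zero : exists Z : acat, is_zero Z;
  has_biprod : forall X Y : acat, inhabited (biprod X Y)
}.

Section IdealQuotient.
Variables (K : addCat) (W : K -> Prop).

Definition additive_subcat : Prop :=
  (exists Z : K, is_zero Z /\ W Z) /\ closed_under_sums W.

Variable hW : additive_subcat.

Definition ideal_pred (_ : additive_subcat) (A B : K) (f : hom A B) : bool :=
  `[< factors_through W f >].

Lemma ideal_closed A B : zmod_closed (@ideal_pred hW A B).
Proof.
have [[Z [_ WZ]] Wsum] := hW; split=> [|f g].
  by apply/asboolP; exists Z; split=> //; exists 0, 0; rewrite comp0m.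
move=> /asboolP[C [WC [f1 [f2 ->]]]] /asboolP[D [WD [g1 [g2 ->]]]].
have [S] := has_biprod C D.
apply/asboolP; exists S; split; first exact: Wsum.
exists (f1 \oc bp_prl S - g1 \oc bp_prr S), (bp_inl S \oc f2 + bp_inr S \oc g2).
rewrite compDl !compDr !compNl -!compA !(compA (bp_prl S)) !(compA (bp_prr S)).
by rewrite bp_ll bp_rr bp_lr bp_rl !comp0m !comp1m !compm0 addr0 oppr0 add0r.
Qed.

HB.instance Definition _ A B :=
  GRing.isZmodClosed.Build (hom A B) (@ideal_pred hW A B) (ideal_closed A B).

Definition ideal A B : zmodClosed (hom A B) :=
  GRing.ZmodClosed.clone _ (@ideal_pred hW A B) _.

Definition qhom (A B : K) : zmodType := Quotient.quot (ideal A B).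

Definition qpi A B (f : hom A B) : qhom A B :=
  \pi_(Quotient.quot (ideal A B))%qT f.

Definition qrepr A B (f : qhom A B) : hom A B :=
  repr (f : Quotient.quot (ideal A B)).

Definition qcomp A B C (g : qhom B C) (f : qhom A B) : qhom A C :=
  qpi (qrepr g \oc qrepr f).

Lemma qpiD A B : {morph @qpi A B : f g / f + g}.
Proof. by move=> f g; rewrite /qpi; apply: raddfD. Qed.

Lemma qpi_eq A B (f g : hom A B) :
  qpi f = qpi g <-> factors_through W (f - g).
Proof.
split=> [e|h].
  suff: f - g \in ideal A B by move/asboolP.
  by rewrite Quotient.idealrBE; apply/eqP.
by apply/eqP; rewrite /qpi -Quotient.idealrBE; apply/asboolP.
Qed.

Lemma qreprK A B (f : qhom A B) : qpi (qrepr f) = f.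
Proof. exact: reprK. Qed.

Lemma qpi_comp A B C (g : hom B C) (f : hom A B) :
  qpi (g \oc f) = qcomp (qpi g) (qpi f).
Proof.
have [X [WX [u [v e1]]]] := (qpi_eq _ _).1 (qreprK (qpi g)).
have [Y [WY [u' [v' e2]]]] := (qpi_eq _ _).1 (qreprK (qpi f)).
rewrite /qcomp; set g' := qrepr _ in e1 *; set f' := qrepr _ in e2 *.
apply: (@etrans _ _ (qpi (g' \oc f))); apply/qpi_eq.
  exists X; split=> //; exists (- u), (v \oc f).
  by rewrite -compNl -compDl compNl compA -e1 -compNl opprB.
exists Y; split=> //; exists (g' \oc (- u')), v'.
by rewrite -compNr -compDr -compA compNl -e2 opprB.
Qed.

Definition quot_preadd : preaddCat.
Proof.
refine (@PreaddCat K qhom (fun A => qpi (idm A)) qcomp _ _ _ _ _).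
- move=> A B C D h g f.
  by rewrite -(qreprK h) -(qreprK g) -(qreprK f) -!qpi_comp compA.
- by move=> A B f; rewrite -(qreprK f) -qpi_comp comp1m.
- by move=> A B f; rewrite -(qreprK f) -qpi_comp compm1.
- move=> A B C g g' f; rewrite -(qreprK g) -(qreprK g') -(qreprK f).
  by rewrite -qpiD -!qpi_comp -qpiD compDl.
- move=> A B C g f f'; rewrite -(qreprK g) -(qreprK f) -(qreprK f').
  by rewrite -qpiD -!qpi_comp -qpiD compDr.
Defined.

Lemma qpi0 A B : qpi (0 : hom A B) = 0.
Proof. exact: raddf0. Qed.

Lemma quot_zero : exists Z : quot_preadd, is_zero Z.
Proof.
have [Z [Z1 Z2]] := has_zero K; exists Z; split=> X f.
  by rewrite -(qreprK f) [qrepr f]Z1 qpi0.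
by rewrite -(qreprK f) [qrepr f]Z2 qpi0.
Qed.

Lemma quot_biprod (X Y : quot_preadd) : inhabited (biprod X Y).
Proof.
have [S] := @has_biprod K X Y; constructor.
apply: (@Biprod quot_preadd X Y S (qpi (bp_inl S)) (qpi (bp_inr S))
         (qpi (bp_prl S)) (qpi (bp_prr S))); rewrite /= -!qpi_comp.
- by rewrite bp_ll.
- by rewrite bp_rr.
- by rewrite bp_lr qpi0.
- by rewrite bp_rl qpi0.
- by rewrite -qpiD bp_id.
Qed.

Definition ideal_quotient : addCat := AddCat quot_zero quot_biprod.

End IdealQuotient.

(* An additive bifunctor E : K^op x K -> Ab: Ext C A is E(C, A), push a is
   E(C, a) and pull c is E(c, A). *)
Record addBifunctor (K : addCat) := AddBifunctor {
  Ext : K -> K -> zmodType;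
  push : forall C A A' : K, hom A A' -> Ext C A -> Ext C A';
  pull : forall C C' A : K, hom C' C -> Ext C A -> Ext C' A;
  pushD : forall C A A' (a : hom A A') (d d' : Ext C A),
    push a (d + d') = push a d + push a d';
  pullD : forall C C' A (c : hom C' C) (d d' : Ext C A),
    pull c (d + d') = pull c d + pull c d';
  push1 : forall C A (d : Ext C A), push (idm A) d = d;
  pull1 : forall C A (d : Ext C A), pull (idm C) d = d;
  push_comp : forall C A A' A'' (a' : hom A' A'') (a : hom A A') (d : Ext C A),
    push (a' \oc a) d = push a' (push a d);
  pull_comp : forall C C' C'' A (c : hom C' C) (c' : hom C'' C') (d : Ext C A),
    pull (c \oc c') d = pull c' (pull c d);
  push_pull : forall C C' A A' (a : hom A A') (c : hom C' C) (d : Ext C A),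
    push a (pull c d) = pull c (push a d);
  push_add : forall C A A' (a a' : hom A A') (d : Ext C A),
    push (a + a') d = push a d + push a' d;
  pull_add : forall C C' A (c c' : hom C' C) (d : Ext C A),
    pull (c + c') d = pull c d + pull c' d
}.

Arguments Ext {K} _ _ _.
Arguments push {K _ C A A'} _ _.
Arguments pull {K _ C C' A} _ _.

Section Extriangulation.
Variables (K : addCat) (E : addBifunctor K).

Definition ext_sum (A A' C C' : K) (SA : biprod A A') (SC : biprod C C')
    (d : Ext E C A) (d' : Ext E C' A') : Ext E SC SA :=
  push (bp_inl SA) (pull (bp_prl SC) d) +
  push (bp_inr SA) (pull (bp_prr SC) d').

(* s d x y reads: the sequence (x, y) belongs to the class s(d). *)
Variable s : forall A B C : K, Ext E C A -> hom A B -> hom B C -> Prop.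

Definition realization_class : Prop :=
  forall (A C : K) (d : Ext E C A),
  exists (B : K) (x : hom A B) (y : hom B C), s d x y /\
    forall (B' : K) (x' : hom A B') (y' : hom B' C),
      s d x' y' <->
      exists b : hom B B', [/\ is_iso b, b \oc x = x' & y' \oc b = y].

Definition realization_map : Prop :=
  forall (A B C A' B' C' : K) (d : Ext E C A) (d' : Ext E C' A')
    (x : hom A B) (y : hom B C) (x' : hom A' B') (y' : hom B' C')
    (a : hom A A') (c : hom C C'),
  s d x y -> s d' x' y' -> push a d = pull c d' ->
  exists b : hom B B', b \oc x = x' \oc a /\ y' \oc b = c \oc y.

Definition realization_split : Prop :=
  forall (A C : K) (S : biprod A C), s (0 : Ext E C A) (bp_inl S) (bp_prr S).

Definition realization_sum : Prop :=
  forall (A B C A' B' C' : K) (d : Ext E C A) (d' : Ext E C' A')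
    (x : hom A B) (y : hom B C) (x' : hom A' B') (y' : hom B' C')
    (SA : biprod A A') (SB : biprod B B') (SC : biprod C C'),
  s d x y -> s d' x' y' ->
  s (ext_sum SA SC d d') (bp_map SA SB x x') (bp_map SB SC y y').

Definition ET3 : Prop :=
  forall (A B C A' B' C' : K) (d : Ext E C A) (d' : Ext E C' A')
    (x : hom A B) (y : hom B C) (x' : hom A' B') (y' : hom B' C')
    (a : hom A A') (b : hom B B'),
  s d x y -> s d' x' y' -> b \oc x = x' \oc a ->
  exists c : hom C C', push a d = pull c d' /\ c \oc y = y' \oc b.

Definition ET3op : Prop :=
  forall (A B C A' B' C' : K) (d : Ext E C A) (d' : Ext E C' A')
    (x : hom A B) (y : hom B C) (x' : hom A' B') (y' : hom B' C')
    (b : hom B B') (c : hom C C'),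
  s d x y -> s d' x' y' -> c \oc y = y' \oc b ->
  exists a : hom A A', push a d = pull c d' /\ b \oc x = x' \oc a.

Definition ET4 : Prop :=
  forall (A B C D F : K) (d : Ext E D A) (d' : Ext E F B)
    (f : hom A B) (f' : hom B D) (g : hom B C) (g' : hom C F),
  s d f f' -> s d' g g' ->
  exists (G : K) (h' : hom C G) (u : hom D G) (v : hom G F) (d'' : Ext E G A),
    [/\ h' \oc g = u \oc f' /\ v \oc h' = g',
        s d'' (g \oc f) h',
        s (push f' d') u v,
        pull u d'' = d
      & push f d'' = pull v d'].

Definition ET4op : Prop :=
  forall (A B C D F : K) (d : Ext E B D) (d' : Ext E C F)
    (f' : hom D A) (f : hom A B) (g' : hom F B) (g : hom B C),
  s d f' f -> s d' g' g ->
  exists (G : K) (h' : hom G A) (u : hom D G) (v : hom G F) (d'' : Ext E C G),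
    [/\ h' \oc u = f' /\ f \oc h' = g' \oc v,
        s d'' h' (g \oc f),
        s (pull g' d) u v,
        push v d'' = d'
      & push u d = pull g d''].

End Extriangulation.

Record extriCat := ExtriCat {
  ecat :> addCat;
  ext : addBifunctor ecat;
  realizes : forall A B C : ecat, Ext ext C A -> hom A B -> hom B C -> Prop;
  realizes_class : realization_class realizes;
  realizes_map : realization_map realizes;
  realizes_split : realization_split realizes;
  realizes_sum : realization_sum realizes;
  realizes_ET3 : ET3 realizes;
  realizes_ET3op : ET3op realizes;
  realizes_ET4 : ET4 realizes;
  realizes_ET4op : ET4op realizes
}.

Arguments realizes {_ A B C} _ _ _.

Definition triangle (E : extriCat) (A B C : E) (x : hom A B) (y : hom B C) :
  Prop := exists d : Ext (ext E) C A, realizes d x y.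

Record hereditary_like (E : extriCat) (W : E -> Prop) : Prop := HereditaryLike {
  hl_proper : exists A : E, ~ W A;
  hl_sums : closed_under_sums W;
  hl_summands : closed_under_summands W;
  hl_left : forall A : E,
    exists (W1 W2 : E) (w : hom A W1) (p : hom W1 W2),
      [/\ triangle w p, W W1, W W2 & left_approx W w];
  hl_right : forall A : E,
    exists (W2 W1 : E) (i : hom W2 W1) (w : hom W1 A),
      [/\ triangle i w, W W1, W W2 & right_approx W w]
}.

Definition cluster_tilting (E : extriCat) (M : E -> Prop) : Prop :=
  hereditary_like M /\
  forall X Y : E, M X -> M Y -> forall d : Ext (ext E) X Y, d = 0.

Lemma hereditary_like_additive (E : extriCat) (W : E -> Prop) :
  hereditary_like W -> additive_subcat W.
Proof.
case=> [[A _] Wsum Wsummand Wleft _]; split=> //.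
have [Z Zz] := has_zero E; exists Z; split=> //.
have [W1 [_ [_ [_ [_ WW1 _ _]]]]] := Wleft A.
apply: Wsummand WW1; exists W1.
have [Z1 Z2] := Zz.
have lr : (0 : hom W1 Z) \oc idm W1 = 0 by rewrite comp0m.
have rl : idm W1 \oc (0 : hom Z W1) = 0 by rewrite compm0.
have ll : (0 : hom W1 Z) \oc (0 : hom Z W1) = idm Z by rewrite [RHS]Z1 comp0m.
have rr : idm W1 \oc idm W1 = idm W1 by rewrite comp1m.
have id1 : (0 : hom Z W1) \oc (0 : hom W1 Z) + idm W1 \oc idm W1 = idm W1.
  by rewrite comp0m add0r comp1m.
exists (Biprod ll rr lr rl id1), (idm W1), (idm W1).
by rewrite !comp1m.
Qed.

(* The closed subfunctor E_P of extensions realized by a triangle whose second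
   map is P-epic, together with the restriction of the realization, forms again
   an extriangulated category; its triangles are the E_P-triangles. *)
Section Relative.
Variables (E : extriCat) (P : E -> Prop).
Implicit Types A B C X Y Z M : E.

Definition rel_pred Z X (d : Ext (ext E) Z X) : bool :=
  `[< exists (Y : E) (x : hom X Y) (y : hom Y Z),
        realizes d x y /\ Wepic P y >].

Lemma push0 C A A' (a : hom A A') : push a (0 : Ext (ext E) C A) = 0.
Proof. by apply: (addrI (push a 0)); rewrite -pushD !addr0. Qed.

Lemma pull0 C C' A (c : hom C' C) : pull c (0 : Ext (ext E) C A) = 0.
Proof. by apply: (addrI (pull c 0)); rewrite -pullD !addr0. Qed.

Lemma zero_triangle_r A Z : is_zero Z ->
  realizes (0 : Ext (ext E) Z A) (idm A) (0 : hom A Z).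
Proof.
move=> [Z1 Z2].
have lr : idm A \oc (0 : hom Z A) = 0 by rewrite compm0.
have rl : (0 : hom A Z) \oc idm A = 0 by rewrite comp0m.
have ll : idm A \oc idm A = idm A by rewrite comp1m.
have rr : (0 : hom A Z) \oc (0 : hom Z A) = idm Z by rewrite [RHS]Z1 comp0m.
have id1 : idm A \oc idm A + (0 : hom Z A) \oc (0 : hom A Z) = idm A.
  by rewrite comp0m addr0 comp1m.
exact: (realizes_split (Biprod ll rr lr rl id1)).
Qed.

Lemma zero_triangle_l A Z : is_zero Z ->
  realizes (0 : Ext (ext E) A Z) (0 : hom Z A) (idm A).
Proof.
move=> [Z1 Z2].
have rl : idm A \oc (0 : hom Z A) = 0 by rewrite compm0.
have lr : (0 : hom A Z) \oc idm A = 0 by rewrite comp0m.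
have rr : idm A \oc idm A = idm A by rewrite comp1m.
have ll : (0 : hom A Z) \oc (0 : hom Z A) = idm Z by rewrite [RHS]Z1 comp0m.
have id1 : (0 : hom Z A) \oc (0 : hom A Z) + idm A \oc idm A = idm A.
  by rewrite comp0m add0r comp1m.
exact: (realizes_split (Biprod ll rr lr rl id1)).
Qed.

Lemma realizes_comp0 A B C (d : Ext (ext E) C A) (x : hom A B) (y : hom B C) :
  realizes d x y -> y \oc x = 0.
Proof.
move=> dxy; have [Z Zz] := has_zero E.
have [|b [b1 b2]] := @realizes_map E _ _ _ _ _ _ _ _ _ _ _ _ (idm A)
  (0 : hom Z C) (zero_triangle_r A Zz) dxy.
  by rewrite push0; apply: (addrI (pull 0 d)); rewrite -pull_add !addr0.
by move: b1 b2; rewrite !compm1 compm0 => <-.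
Qed.

Lemma realizes_exact A B C (d : Ext (ext E) C A) (x : hom A B) (y : hom B C)
    M (f : hom M B) :
  realizes d x y -> y \oc f = 0 -> exists g : hom M A, x \oc g = f.
Proof.
move=> dxy yf0; have [Z Zz] := has_zero E.
have [|a [_ a2]] := @realizes_ET3op E _ _ _ _ _ _ _ _ _ _ _ _ f
  (0 : hom Z C) (zero_triangle_r M Zz) dxy.
  by rewrite yf0 compm0.
by exists a; rewrite -a2 compm1.
Qed.

Lemma realizes_lift A B C (d : Ext (ext E) C A) (x : hom A B) (y : hom B C)
    M (f : hom M C) :
  realizes d x y -> pull f d = 0 <-> exists g : hom M B, y \oc g = f.
Proof.
move=> dxy; split=> [fd0|[g <-]].
  have [S] := has_biprod A M.
  have [|b [_ b2]] := @realizes_map E _ _ _ _ _ _ _ _ _ _ _ _ (idm A) f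
    (realizes_split S) dxy.
    by rewrite push0 fd0.
  by exists (b \oc bp_inr S); rewrite compA b2 -compA bp_rr compm1.
have [Z Zz] := has_zero E; rewrite pull_comp.
have [|a [<- _]] := @realizes_ET3op E _ _ _ _ _ _ _ _ _ _ _ _ (idm B) y
  (zero_triangle_l B Zz) dxy; first by [].
by rewrite push0 pull0.
Qed.

Lemma rel_predP Z X (d : Ext (ext E) Z X) :
  reflect (forall M, P M -> forall f : hom M Z, pull f d = 0) (rel_pred d).
Proof.
apply: (iffP (asboolP _)) => [[Y [x [y [dxy ye]]]] M PM f|h].
  by apply/(realizes_lift _ dxy); apply: ye.
have [Y [x [y [dxy _]]]] := realizes_class d.
exists Y, x, y; split=> // M PM f.
by apply/(realizes_lift _ dxy); apply: h.
Qed.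

Lemma rel_pred_epic A B C (d : Ext (ext E) C A) (x : hom A B) (y : hom B C) :
  realizes d x y -> rel_pred d -> Wepic P y.
Proof.
by move=> dxy /rel_predP h M PM f; apply/(realizes_lift _ dxy); apply: h.
Qed.

Lemma rel_closed Z X : zmod_closed (@rel_pred Z X).
Proof.
split=> [|d d' /rel_predP h /rel_predP h']; apply/rel_predP => M PM f.
  exact: pull0.
apply: (addIr (pull f d')); rewrite -pullD subrK add0r.
by rewrite h // h'.
Qed.

HB.instance Definition _ Z X :=
  GRing.isZmodClosed.Build (Ext (ext E) Z X) (@rel_pred Z X) (rel_closed Z X).

Record rel_Ext Z X := RelExt {
  rel_val :> Ext (ext E) Z X;
  rel_valP : rel_pred rel_val
}.

HB.instance Definition _ Z X := [isSub for @rel_val Z X].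
HB.instance Definition _ Z X := [Choice of rel_Ext Z X by <:].
HB.instance Definition _ Z X := [SubChoice_isSubZmodule of rel_Ext Z X by <:].

Lemma rel_pushP C A A' (a : hom A A') (d : rel_Ext C A) :
  rel_pred (push a (rel_val d)).
Proof.
apply/rel_predP => M PM f; rewrite -push_pull.
by rewrite (rel_predP _ (rel_valP d)) // push0.
Qed.

Lemma rel_pullP C C' A (c : hom C' C) (d : rel_Ext C A) :
  rel_pred (pull c (rel_val d)).
Proof.
apply/rel_predP => M PM f; rewrite -pull_comp.
exact: (rel_predP _ (rel_valP d)).
Qed.

Definition rel_ext : addBifunctor E.
Proof.
refine (@AddBifunctor E (fun C A => rel_Ext C A : zmodType)
  (fun C A A' a d => RelExt (rel_pushP a d))
  (fun C C' A c d => RelExt (rel_pullP c d)) _ _ _ _ _ _ _ _ _);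
  move=> *; apply: val_inj => /=.
- exact: pushD.
- exact: pullD.
- exact: push1.
- exact: pull1.
- exact: push_comp.
- exact: pull_comp.
- exact: push_pull.
- exact: push_add.
- exact: pull_add.
Defined.

Definition rel_realizes A B C (d : Ext rel_ext C A) (x : hom A B)
  (y : hom B C) : Prop := realizes (rel_val d) x y.

Lemma rel_ET4 : ET4 rel_realizes.
Proof.
move=> A B C D F d d' f f' g g' dff dgg.
have [G [h' [u [v [d'' [[e1 e2] r1 r2 e3 e4]]]]]] := realizes_ET4 dff dgg.
have Pd'' : rel_pred d''.
  apply/rel_predP => M PM k; apply/(realizes_lift _ r1).
  have [w ew] := rel_pred_epic dgg (rel_valP d') PM (v \oc k).
  have vk0 : v \oc (k - h' \oc w) = 0.
    by rewrite compDr compNr compA e2 ew subrr.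
  have [t et] := realizes_exact r2 vk0.
  have [q eq] := rel_pred_epic dff (rel_valP d) PM t.
  exists (w + g \oc q).
  by rewrite compDr compA e1 -compA eq et addrC subrK.
exists G, h', u, v, (RelExt Pd''); split=> //.
- exact: val_inj.
- exact: val_inj.
Qed.

Lemma rel_ET4op : ET4op rel_realizes.
Proof.
move=> A B C D F d d' f' f g' g dff dgg.
have [G [h' [u [v [d'' [e1 r1 r2 e3 e4]]]]]] := realizes_ET4op dff dgg.
have Pd'' : rel_pred d''.
  apply/rel_predP => M PM k; apply/(realizes_lift _ r1).
  have [w ew] := rel_pred_epic dgg (rel_valP d') PM k.
  have [t et] := rel_pred_epic dff (rel_valP d) PM w.
  by exists t; rewrite -compA et.
exists G, h', u, v, (RelExt Pd''); split=> //.
- exact: val_inj.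
- exact: val_inj.
Qed.

Definition relative : extriCat.
Proof.
refine (@ExtriCat E rel_ext rel_realizes _ _ _ _ _ _ rel_ET4 rel_ET4op).
- by move=> A C d; apply: (realizes_class (rel_val d)).
- move=> A B C A' B' C' d d' x y x' y' a c r r' /(congr1 (@rel_val _ _)) e.
  exact: realizes_map r r' e.
- by move=> A C S; apply: realizes_split.
- move=> A B C A' B' C' d d' x y x' y' SA SB SC r r'.
  exact: (realizes_sum SA SB SC r r').
- move=> A B C A' B' C' d d' x y x' y' a b r r' e.
  have [c [ec1 ec2]] := realizes_ET3 r r' e.
  by exists c; split=> //; apply: val_inj.
- move=> A B C A' B' C' d d' x y x' y' b c r r' e.
  have [a [ea1 ea2]] := realizes_ET3op r r' e.
  by exists a; split=> //; apply: val_inj.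
Defined.

End Relative.

(* e_part is the subcategory written with a left index e, e_complement is
   W \ e_part, and relative_e is the category with extensions E_e. *)
Section EpsilonPart.
Variables (E : extriCat) (W : E -> Prop).

Definition e_part (C : E) : Prop :=
  W C /\
  exists (A B : E) (a : hom A B) (b : hom B C),
    [/\ triangle a b, left_minimal a & Wmonic W a].

Definition e_free (C : E) : Prop :=
  W C /\ forall X : E, is_summand X C -> e_part X -> is_zero X.

Definition e_complement : E -> Prop := additive_closure e_free.

Definition relative_e : extriCat := relative e_complement.

End EpsilonPart.

(* Main.v *)
(* Morphisms are computed modulo those factoring through [W].  For a W-monic
   triangle A -> B -> C the map B -> C is a cokernel in E/W, and dually, so E/W
   always has kernels and cokernels; it is abelian iff monos and epis are normal.
   If E(W, W) = 0 then a monomorphism m modulo W is injective on E(V, -) for V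
   in W, which makes m the kernel of its cokernel.

   Conversely let E/W be abelian.  The classes in E(U, A), U in W, whose
   triangle A -> B -> U is W-monic form a left exact functor of A in E/W, and
   the smallest subobject P of A carrying a given class has a triangle
   P -> B -> U with B in W (a "generating" class).  If End U is local, P is a
   local object: the sum of two proper subobjects is proper.  Hence every object
   of E/W is a finite sum of local subobjects and, dually, embeds into a finite
   sum of uniform objects.  With left local finiteness this makes every epic
   endomorphism of a local object monic, so for each U there is a generating
   class P -> B -> U that no other generating class properly dominates.  Now
   splice it with a resolution P' -> B' -> B by generating classes: the outcome
   M -> B' -> U is generating and dominates the first one, so P' -> M vanishes
   in E/W, and this forces every class of E_e(U, W) to vanish. *)
From HB Require Import structures.
From mathcomp Require Import all_boot all_algebra.
From mathcomp Require Import boolp.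
Require Import Defs.

Set Implicit Arguments.
Unset Strict Implicit.
Unset Printing Implicit Defensive.

Import GRing.Theory.

Local Open Scope ring_scope.
Local Open Scope cat_scope.

(** * Monomorphisms, biproducts, local objects and the radical in a preadditive category *)

Section PreadditiveFacts.
Variable K : preaddCat.
Implicit Types A B C T X Y Z : K.

Lemma compBl A B C (g g' : hom B C) (f : hom A B) :
  (g - g') \oc f = g \oc f - g' \oc f.
Proof. by rewrite compDl compNl. Qed.

Lemma compBr A B C (g : hom B C) (f f' : hom A B) :
  g \oc (f - f') = g \oc f - g \oc f'.
Proof. by rewrite compDr compNr. Qed.

Lemma comp_sumr A B C (g : hom B C) n (f : 'I_n -> hom A B) :
  g \oc (\sum_(k < n) f k) = \sum_(k < n) g \oc f k.
Proof.
elim/big_rec2: _ => [|k x y _ <-]; first exact: compm0.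
by rewrite compDr.
Qed.

Lemma comp_suml A B C (f : hom A B) n (g : 'I_n -> hom B C) :
  (\sum_(k < n) g k) \oc f = \sum_(k < n) g k \oc f.
Proof.
elim/big_rec2: _ => [|k x y _ <-]; first exact: comp0m.
by rewrite compDl.
Qed.

Lemma is_iso_id A : is_iso (idm A).
Proof. by exists (idm A); rewrite comp1m. Qed.

Lemma is_iso_comp A B C (g : hom B C) (f : hom A B) :
  is_iso g -> is_iso f -> is_iso (g \oc f).
Proof.
move=> [g' [g1 g2]] [f' [f1 f2]]; exists (f' \oc g'); split.
  by rewrite compA -(compA f') g1 compm1 f1.
by rewrite compA -(compA g) f2 compm1 g2.
Qed.

Lemma two_sided_iso A B (f : hom A B) (g h : hom B A) :
  is_iso (f \oc g) -> is_iso (h \oc f) -> is_iso f.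
Proof.
move=> [u [_ u2]] [v [v1 _]].
have e1 : f \oc (g \oc u) = idm B by rewrite compA.
have e2 : (v \oc h) \oc f = idm A by rewrite -compA.
exists (g \oc u); split=> //.
suff -> : g \oc u = v \oc h by [].
by rewrite -[LHS]comp1m -e2 -compA e1 compm1.
Qed.

Lemma isomorphic_sym A B : isomorphic A B -> isomorphic B A.
Proof. by move=> [f [g [e1 e2]]]; exists g, f. Qed.

Lemma isomorphic_trans A B C :
  isomorphic A B -> isomorphic B C -> isomorphic A C.
Proof.
by move=> [f hf] [g hg]; exists (g \oc f); apply: is_iso_comp.
Qed.

Lemma is_zeroP Z : is_zero Z <-> idm Z = 0.
Proof.
split=> [[h _]|e]; first exact: h.
by split=> X f; [rewrite -(comp1m f) e comp0m | rewrite -(compm1 f) e compm0].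
Qed.

Definition mono0 A B (f : hom A B) : Prop :=
  forall T (t : hom T A), f \oc t = 0 -> t = 0.

Definition epi0 A B (f : hom A B) : Prop :=
  forall T (t : hom B T), t \oc f = 0 -> t = 0.

Lemma is_monoP A B (f : hom A B) : is_mono f <-> mono0 f.
Proof.
split=> h T; first by move=> t e; apply: h; rewrite e compm0.
move=> u v e; apply/eqP; rewrite -subr_eq0; apply/eqP/h.
by rewrite compBr e subrr.
Qed.

Lemma is_epiP A B (f : hom A B) : is_epi f <-> epi0 f.
Proof.
split=> h T; first by move=> t e; apply: h; rewrite e comp0m.
move=> u v e; apply/eqP; rewrite -subr_eq0; apply/eqP/h.
by rewrite compBl e subrr.
Qed.

Lemma mono0_comp A B C (g : hom B C) (f : hom A B) :
  mono0 g -> mono0 f -> mono0 (g \oc f).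
Proof. by move=> hg hf T t; rewrite -compA => /hg /hf. Qed.

Lemma epi0_comp A B C (g : hom B C) (f : hom A B) :
  epi0 g -> epi0 f -> epi0 (g \oc f).
Proof. by move=> hg hf T t; rewrite compA => /hf /hg. Qed.

Lemma epi0_of_comp A B C (g : hom B C) (f : hom A B) :
  epi0 (g \oc f) -> epi0 g.
Proof. by move=> h T t e; apply: h; rewrite compA e comp0m. Qed.

Lemma mono0_of_comp A B C (g : hom B C) (f : hom A B) :
  mono0 (g \oc f) -> mono0 f.
Proof. by move=> h T t e; apply: h; rewrite -compA e compm0. Qed.

Lemma iso_mono0 A B (f : hom A B) : is_iso f -> mono0 f.
Proof.
by move=> [g [e _]] T t h; rewrite -(comp1m t) -e -compA h compm0.
Qed.

Lemma iso_epi0 A B (f : hom A B) : is_iso f -> epi0 f.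
Proof.
by move=> [g [_ e]] T t h; rewrite -(compm1 t) -e compA h comp0m.
Qed.

Lemma bp_ext_out X Y (S : biprod X Y) T (f g : hom S T) :
  f \oc bp_inl S = g \oc bp_inl S -> f \oc bp_inr S = g \oc bp_inr S -> f = g.
Proof.
move=> e1 e2; rewrite -(compm1 f) -(compm1 g) -(bp_id S) !compDr !compA.
by rewrite e1 e2.
Qed.

Lemma bp_ext_in X Y (S : biprod X Y) T (f g : hom T S) :
  bp_prl S \oc f = bp_prl S \oc g -> bp_prr S \oc f = bp_prr S \oc g -> f = g.
Proof.
move=> e1 e2; rewrite -(comp1m f) -(comp1m g) -(bp_id S) !compDl -!compA.
by rewrite e1 e2.
Qed.

Lemma bp_in_dec X Y (S : biprod X Y) T (f : hom T S) :
  f = bp_inl S \oc (bp_prl S \oc f) + bp_inr S \oc (bp_prr S \oc f).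
Proof. by rewrite !compA -compDl bp_id comp1m. Qed.

Lemma bp_pair_prl X Y (S : biprod X Y) T (f : hom T X) (g : hom T Y) :
  bp_prl S \oc (bp_inl S \oc f + bp_inr S \oc g) = f.
Proof. by rewrite compDr !compA bp_ll bp_lr comp1m comp0m addr0. Qed.

Lemma bp_pair_prr X Y (S : biprod X Y) T (f : hom T X) (g : hom T Y) :
  bp_prr S \oc (bp_inl S \oc f + bp_inr S \oc g) = g.
Proof. by rewrite compDr !compA bp_rr bp_rl comp1m comp0m add0r. Qed.

Lemma bp_copair_inl X Y (S : biprod X Y) T (f : hom X T) (g : hom Y T) :
  (f \oc bp_prl S + g \oc bp_prr S) \oc bp_inl S = f.
Proof. by rewrite compDl -!compA bp_ll bp_rl compm1 compm0 addr0. Qed.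

Lemma bp_copair_inr X Y (S : biprod X Y) T (f : hom X T) (g : hom Y T) :
  (f \oc bp_prl S + g \oc bp_prr S) \oc bp_inr S = g.
Proof. by rewrite compDl -!compA bp_rr bp_lr compm1 compm0 add0r. Qed.

Lemma local_not_zero X : local_End X -> ~ is_zero X.
Proof. by move=> [h _] /is_zeroP. Qed.

Lemma local_iso X : local_End X ->
  forall f : hom X X, is_iso f \/ is_iso (idm X - f).
Proof.
move=> [_ h] f; apply: h; rewrite addrC subrK; exact: is_iso_id.
Qed.

Lemma local_sum_iso X : local_End X -> forall n (f : 'I_n -> hom X X),
  \sum_(k < n) f k = idm X -> exists k, is_iso (f k).
Proof.
move=> hX n f e.
suff h : forall m (g : 'I_m -> hom X X), is_iso (\sum_(k < m) g k) ->
    exists k, is_iso (g k) by apply: h; rewrite e; apply: is_iso_id.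
elim=> [|m IHm] g.
  rewrite big_ord0 => -[u [e0 _]]; case: hX => + _; case.
  by rewrite -e0 compm0.
rewrite big_ord_recl => /hX.2 [h|/IHm [k hk]]; first by exists ord0.
by exists (lift ord0 k).
Qed.

(** The Jacobson radical of the category, given by its one-sided invertibility test; [jacobson]
    supplies the other side. *)
Definition radical X Y (f : hom X Y) : Prop :=
  forall g : hom Y X, is_iso (idm Y - f \oc g).

(** If [u] inverts [1 - f g], then [1 + g u f] inverts [1 - g f]. *)
Lemma jacobson X Y (f : hom X Y) (g : hom Y X) :
  is_iso (idm Y - f \oc g) -> is_iso (idm X - g \oc f).
Proof.
move=> [u [u1 u2]].
have e1 : u \oc (f \oc g) = u - idm Y.
  by rewrite -u1 compBr compm1 opprB addrC subrK.
have e2 : f \oc g \oc u = u - idm Y.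
  by rewrite -u2 compBl comp1m opprB addrC subrK.
set v := g \oc (u \oc f).
have k1 : v \oc (g \oc f) = v - g \oc f.
  rewrite /v; transitivity (g \oc (u \oc (f \oc g) \oc f)).
    by rewrite !compA.
  by rewrite e1 compBl comp1m compBr.
have k2 : (g \oc f) \oc v = v - g \oc f.
  rewrite /v; transitivity (g \oc (f \oc g \oc u \oc f)).
    by rewrite !compA.
  by rewrite e2 compBl comp1m compBr.
have e : idm X - g \oc f + v - (v - g \oc f) = idm X.
  by rewrite opprB addrA [_ + v + _]addrAC subrK addrK.
exists (idm X + v); split.
  by rewrite compDl comp1m compBr compm1 k1 addrA.
by rewrite compDr compm1 compBl comp1m k2 addrA.
Qed.

Lemma radical_compr X Y Z (f : hom Y Z) (u : hom X Y) :
  radical f -> radical (f \oc u).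
Proof. by move=> h g; rewrite -compA; apply: h. Qed.

Lemma radical_compl X Y Z (u : hom Y Z) (f : hom X Y) :
  radical f -> radical (u \oc f).
Proof.
move=> h g; rewrite -compA; apply: jacobson; rewrite -compA; exact: h.
Qed.

Lemma radicalD X Y (f f' : hom X Y) :
  radical f -> radical f' -> radical (f + f').
Proof.
move=> h h' g; have [u [u1 u2]] := h g.
suff -> : idm Y - (f + f') \oc g =
    (idm Y - f' \oc (g \oc u)) \oc (idm Y - f \oc g).
  by apply: is_iso_comp => //; apply: h'.
by rewrite [RHS]compBl comp1m -!compA u1 compm1 compDl opprD addrA.
Qed.

Lemma radical0 X Y : radical (0 : hom X Y).
Proof. by move=> g; rewrite comp0m subr0; apply: is_iso_id. Qed.

Lemma dsum_bin n (Y : 'I_n.+1 -> K) Z R (k : 'I_n.+1) :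
  is_direct_sum Y Z -> is_direct_sum (fun l => Y (lift k l)) R ->
  exists S : biprod (Y k) R, bp_obj S = Z.
Proof.
move=> [i [p [pi pi0 ip]]] [i' [p' [pi' pi0' ip']]].
pose inr : hom R Z := \sum_(l < n) i (lift k l) \oc p' l.
pose prr : hom Z R := \sum_(l < n) i' l \oc p (lift k l).
have lr : p k \oc inr = 0.
  rewrite comp_sumr big1 // => l _.
  by rewrite compA pi0 ?comp0m // neq_lift.
have rl : prr \oc i k = 0.
  rewrite comp_suml big1 // => l _.
  by rewrite -compA pi0 ?compm0 // eq_sym neq_lift.
have rr : prr \oc inr = idm R.
  rewrite comp_suml -ip'; apply: eq_bigr => l _.
  rewrite comp_sumr (bigD1 l) //= big1 => [|m nm].
    by rewrite addr0 compA -(compA (i' l)) pi compm1.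
  rewrite compA -(compA (i' l)) pi0 ?compm0 ?comp0m //.
  by apply: contra_neq nm => /lift_inj.
have id1 : i k \oc p k + inr \oc prr = idm Z.
  rewrite -ip (bigD1_ord k) //=; congr (_ + _).
  rewrite comp_suml; apply: eq_bigr => l _.
  rewrite comp_sumr (bigD1 l) //= big1 => [|m nm].
    by rewrite addr0 compA -(compA (i _)) pi' compm1.
  by rewrite compA -(compA (i _)) pi0' ?compm0 ?comp0m // eq_sym.
by exists (Biprod (pi k) rr lr rl id1).
Qed.

End PreadditiveFacts.

(** * Finite direct sums, and closure of subcategories under them *)

Section AdditiveFacts.
Variable K : addCat.
Implicit Types A B C T X Y Z : K.

Lemma dsum_exists n (Y : 'I_n -> K) : exists Z, is_direct_sum Y Z.
Proof.
elim: n Y => [|n IHn] Y.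
  have [Z hZ] := has_zero K; exists Z.
  have d (k : 'I_0) : False by case: k.
  exists (fun k => match d k with end), (fun k => match d k with end).
  by split=> [[]|[]|] //; rewrite big_ord0; symmetry; apply/is_zeroP.
have [R [i [p [pi pi0 ip]]]] := IHn (fun l => Y (lift ord0 l)).
have [S] := has_biprod (Y ord0) R; exists S.
(* An index equals [ord0] or a lift only up to an equation, so each component is transported along
   it; [eq_axiomK] removes the transport when the index is concrete. *)
pose I k : hom (Y k) S := match unliftP ord0 k in @unlift_spec _ _ _ o
  return hom (Y k) S with
  | UnliftSome j e => bp_inr S \oc ecast k (hom (Y k) R) (esym e) (i j)
  | UnliftNone e => ecast k (hom (Y k) S) (esym e) (bp_inl S)
  end.
pose P k : hom S (Y k) := match unliftP ord0 k in @unlift_spec _ _ _ o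
  return hom S (Y k) with
  | UnliftSome j e => ecast k (hom R (Y k)) (esym e) (p j) \oc bp_prr S
  | UnliftNone e => ecast k (hom S (Y k)) (esym e) (bp_prl S)
  end.
have I0 : I ord0 = bp_inl S.
  rewrite /I; case: unliftP => [j e|e]; last by rewrite eq_axiomK.
  by case/eqP: (neq_lift ord0 j).
have P0 : P ord0 = bp_prl S.
  rewrite /P; case: unliftP => [j e|e]; last by rewrite eq_axiomK.
  by case/eqP: (neq_lift ord0 j).
have I1 l : I (lift ord0 l) = bp_inr S \oc i l.
  rewrite /I; case: unliftP => [j e|e].
    by have ej := lift_inj e; subst j; rewrite eq_axiomK.
  by case/eqP: (neq_lift ord0 l).
have P1 l : P (lift ord0 l) = p l \oc bp_prr S.
  rewrite /P; case: unliftP => [j e|e].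
    by have ej := lift_inj e; subst j; rewrite eq_axiomK.
  by case/eqP: (neq_lift ord0 l).
exists I, P; split.
- move=> k; case: (unliftP ord0 k) => [j ->|->]; last by rewrite I0 P0 bp_ll.
  by rewrite I1 P1 -compA (compA _ _ (i j)) bp_rr comp1m.
- move=> k l; case: (unliftP ord0 k) => [j ->|->];
  case: (unliftP ord0 l) => [j' ->|->].
  + move=> nj; rewrite I1 P1 -compA (compA _ _ (i j')) bp_rr comp1m pi0 //.
  + by rewrite I0 P1 -compA bp_rl compm0.
  + by rewrite I1 P0 compA bp_lr comp0m.
  + by rewrite eqxx.
- rewrite big_ord_recl I0 P0 -(bp_id S); congr (_ + _).
  rewrite -[bp_prr S in RHS]comp1m -ip comp_suml comp_sumr.
  by apply: eq_bigr => l _; rewrite I1 P1 !compA.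
Qed.

Lemma dsum_split n (Y : 'I_n.+1 -> K) Z (k : 'I_n.+1) : is_direct_sum Y Z ->
  exists R (S : biprod (Y k) R),
    is_direct_sum (fun l => Y (lift k l)) R /\ bp_obj S = Z.
Proof.
move=> hZ; have [R hR] := dsum_exists (fun l => Y (lift k l)).
by have [S hS] := dsum_bin hZ hR; exists R, S.
Qed.

Lemma dsum_summand n (Y : 'I_n -> K) Z k : is_direct_sum Y Z ->
  is_summand (Y k) Z.
Proof.
case: n Y k => [Y []//|n Y k] /(@dsum_split _ _ _ k) [R [S [_ <-]]].
by exists R, S, (idm S); apply: is_iso_id.
Qed.

Lemma zero_biprod Z A : is_zero Z -> exists S : biprod A Z, bp_obj S = A.
Proof.
move=> /is_zeroP Z1.
have lr : idm A \oc (0 : hom Z A) = 0 by rewrite compm0.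
have rl : (0 : hom A Z) \oc idm A = 0 by rewrite comp0m.
have ll : idm A \oc idm A = idm A by rewrite comp1m.
have rr : (0 : hom A Z) \oc (0 : hom Z A) = idm Z by rewrite Z1 comp0m.
have id1 : idm A \oc idm A + (0 : hom Z A) \oc (0 : hom A Z) = idm A.
  by rewrite comp0m addr0 comp1m.
by exists (Biprod ll rr lr rl id1).
Qed.

Lemma iso_summand A B : isomorphic A B -> is_summand A B.
Proof.
move=> h; have [Z hZ] := has_zero K.
by have [S e] := zero_biprod A hZ; exists Z, S; rewrite e.
Qed.

Lemma dsum1 Y : is_direct_sum (fun _ : 'I_1 => Y) Y.
Proof.
exists (fun _ => idm Y), (fun _ => idm Y); split=> [k|k l|].
- by rewrite comp1m.
- by rewrite !ord1.
- by rewrite big_ord1 comp1m.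
Qed.

Section ClosedSubcategory.
Variable W : K -> Prop.
Hypotheses (Wsum : closed_under_sums W) (Wsd : closed_under_summands W).

Lemma closed_iso A B : isomorphic A B -> W B -> W A.
Proof. by move=> /iso_summand; apply: Wsd. Qed.

Lemma closed_dsum n (Y : 'I_n -> K) Z : (exists A, W A) ->
  is_direct_sum Y Z -> (forall k, W (Y k)) -> W Z.
Proof.
move=> [A WA]; elim: n Y Z => [|n IHn] Y Z hZ hY.
  have Z0 : is_zero Z.
    by apply/is_zeroP; case: hZ => i [p [_ _ <-]]; rewrite big_ord0.
  apply: Wsd WA; have [S e] := zero_biprod A Z0.
  exists A; case: S e => T inl inr prl prr ll rr lr rl id1 /= e; subst T.
  rewrite addrC in id1.
  by exists (Biprod rr ll rl lr id1), (idm A); apply: is_iso_id.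
have [R [S [hR <-]]] := dsum_split ord0 hZ.
by apply: Wsum => //; apply: IHn hR _.
Qed.

End ClosedSubcategory.
End AdditiveFacts.

(** * Opposite extriangulated category *)

Section Opposite.

Definition bp_swap (K : preaddCat) (X Y : K) (S : biprod X Y) : biprod Y X :=
  @Biprod K Y X S (bp_inr S) (bp_inl S) (bp_prr S) (bp_prl S)
    (bp_rr S) (bp_ll S) (bp_rl S) (bp_lr S) (etrans (addrC _ _) (bp_id S)).

Definition op_preadd (K : preaddCat) : preaddCat.
Proof.
refine (@PreaddCat K (fun A B => hom B A) (fun A => idm A)
  (fun A B C g f => f \oc g) _ _ _ _ _) => *.
- by rewrite compA.
- exact: compm1.
- exact: comp1m.
- exact: compDr.
- exact: compDl.
Defined.

Definition op_biprod (K : preaddCat) (X Y : K) (S : biprod X Y) :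
    @biprod (op_preadd K) X Y :=
  @Biprod (op_preadd K) X Y S (bp_prl S) (bp_prr S) (bp_inl S) (bp_inr S)
    (bp_ll S) (bp_rr S) (bp_rl S) (bp_lr S) (bp_id S).

Definition unop_biprod (K : preaddCat) (X Y : K)
    (S : @biprod (op_preadd K) X Y) : biprod X Y :=
  @Biprod K X Y S (bp_prl S) (bp_prr S) (bp_inl S) (bp_inr S)
    (bp_ll S) (bp_rr S) (bp_rl S) (bp_lr S) (bp_id S).

Lemma op_is_zero (K : preaddCat) (Z : K) :
  is_zero Z -> @is_zero (op_preadd K) Z.
Proof. by case. Qed.

Definition op_add (K : addCat) : addCat.
Proof.
refine (@AddCat (op_preadd K) _ _).
- by have [Z hZ] := has_zero K; exists Z; apply: op_is_zero.
- by move=> X Y; have [S] := @has_biprod K X Y; constructor; apply: op_biprod.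
Defined.

Lemma op_is_iso (K : preaddCat) (A B : K) (f : hom A B) :
  @is_iso (op_preadd K) B A f <-> is_iso f.
Proof. by split=> -[g [e1 e2]]; exists g. Qed.

Lemma op_isomorphic (K : preaddCat) (A B : K) :
  @isomorphic (op_preadd K) A B <-> isomorphic A B.
Proof.
by split=> [[f [g [e1 e2]]]|[f [g [e1 e2]]]]; exists g, f.
Qed.

Lemma op_local (K : preaddCat) (A : K) :
  @local_End (op_preadd K) A <-> local_End A.
Proof.
split=> -[h1 h2]; split=> // f g.
  by move=> /op_is_iso /(h2 f g) [] /op_is_iso; [left|right].
by move=> /op_is_iso /(h2 f g) [] /op_is_iso; [left|right].
Qed.

Lemma op_direct_sum (K : preaddCat) n (Y : 'I_n -> K) (Z : K) :
  @is_direct_sum (op_preadd K) n Y Z <-> is_direct_sum Y Z.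
Proof.
split=> -[i [p [pi pi0 ip]]]; exists p, i; split=> // k l nkl;
  by apply: (pi0 l k); rewrite eq_sym.
Qed.

Lemma op_summand (K : preaddCat) (X Z : K) :
  @is_summand (op_preadd K) X Z <-> is_summand X Z.
Proof.
split=> -[Y [S hS]]; exists Y.
  by exists (unop_biprod S); apply/op_isomorphic.
by exists (op_biprod S); apply/op_isomorphic.
Qed.

Lemma op_krull_schmidt (K : preaddCat) :
  krull_schmidt K -> krull_schmidt (op_preadd K).
Proof.
move=> h X; have [n [Y [h1 h2]]] := h X; exists n, Y.
by split=> [k|]; [apply/op_local | apply/op_direct_sum].
Qed.

Definition op_bifun (K : addCat) (E : addBifunctor K) :
  addBifunctor (op_add K).
Proof.
refine (@AddBifunctor (op_add K) (fun C A => Ext E A C)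
  (fun C A A' (a : @hom K A' A) d => pull a d)
  (fun C C' A (c : @hom K C C') d => push c d)
  _ _ _ _ _ _ _ _ _) => *.
- exact: pullD.
- exact: pushD.
- exact: pull1.
- exact: push1.
- exact: pull_comp.
- exact: push_comp.
- by rewrite push_pull.
- exact: pull_add.
- exact: push_add.
Defined.

(** The axioms are self-dual: ET3 and ET4 trade places with their opposites. Dual statements are
    later read off from this category. *)
Definition op_extri (E : extriCat) : extriCat.
Proof.
refine (@ExtriCat (op_add E) (op_bifun (ext E))
  (fun A B C d x y => realizes (d : Ext (ext E) A C) y x)
  _ _ _ _ _ _ _ _).
- move=> A C d; have [B [x [y [h1 h2]]]] := @realizes_class E C A d.
  exists B, y, x; split=> // B' x' y'.
  split=> [/h2 [b [[b' [e1 e2]] ex ey]]|[b [[b' [/= e1 e2]] /= ex ey]]].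
    exists b'; split; first by exists b.
      by rewrite /= -ey -compA e2 compm1.
    by rewrite /= -ex compA e1 comp1m.
  apply/h2; exists b'; split; first by exists b.
    by rewrite -ey compA e2 comp1m.
  by rewrite -ex -compA e1 compm1.
- move=> A B C A' B' C' d d' x y x' y' a c r r' e.
  by have [b [b1 b2]] := realizes_map r' r (esym e); exists b.
- by move=> A C S; apply: (realizes_split (bp_swap (unop_biprod S))).
- move=> A B C A' B' C' d d' x y x' y' SA SB SC r r'.
  have := realizes_sum (unop_biprod SC) (unop_biprod SB) (unop_biprod SA) r r'.
  rewrite /ext_sum /bp_map /= !compA !push_pull; exact: id.
- move=> A B C A' B' C' d d' x y x' y' a b r r' e.
  by have [c [c1 c2]] := realizes_ET3op r' r (esym e); exists c.
- move=> A B C A' B' C' d d' x y x' y' b c r r' e.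
  by have [a [a1 a2]] := realizes_ET3 r' r (esym e); exists a.
- move=> A B C D F d d' f f' g g' r r'.
  have [G [h' [u [v [d'' [[e1 e2] r1 r2 e3 e4]]]]]] := realizes_ET4op r' r.
  by exists G, h', v, u, d''.
- move=> A B C D F d d' f f' g g' r r'.
  have [G [h' [u [v [d'' [[e1 e2] r1 r2 e3 e4]]]]]] := realizes_ET4 r' r.
  by exists G, h', v, u, d''.
Defined.

Lemma op_triangle (E : extriCat) (A B C : E) (x : hom A B) (y : hom B C) :
  triangle x y -> @triangle (op_extri E) C B A y x.
Proof. by move=> [d h]; exists d. Qed.

Lemma op_hereditary_like (E : extriCat) (W : E -> Prop) :
  hereditary_like W -> @hereditary_like (op_extri E) W.
Proof.
move=> [h1 h2 h3 h4 h5]; split=> //.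
- by move=> X Y S; apply: (h2 X Y (unop_biprod S)).
- by move=> X Z /op_summand; apply: h3.
- move=> A; have [W2 [W1 [i [w [t w1 w2 [_ a]]]]]] := h5 A.
  by exists W1, W2, w, i; split=> //; apply: op_triangle.
- move=> A; have [W1 [W2 [w [p [t w1 w2 [_ a]]]]]] := h4 A.
  by exists W2, W1, p, w; split=> //; apply: op_triangle.
Qed.

End Opposite.

(** * Exact sequences of a triangle *)

Section Triangles.
Variable E : extriCat.
Implicit Types A B C T U X Y Z : E.

Lemma realizes_push_l A B C (d : Ext (ext E) C A) (x : hom A B) (y : hom B C) :
  realizes d x y -> push x d = 0.
Proof.
move=> r; apply/(@realizes_lift (op_extri E) C B A d y x B x r).
by exists (idm B); rewrite /= comp1m.
Qed.

Lemma realizes_pull_r A B C (d : Ext (ext E) C A) (x : hom A B) (y : hom B C) :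
  realizes d x y -> pull y d = 0.
Proof.
by move=> r; apply/(realizes_lift _ r); exists (idm B); rewrite compm1.
Qed.

Lemma pull_zero C C' A (d : Ext (ext E) C A) :
  pull (0 : hom C' C) d = 0.
Proof. by apply: (addrI (pull 0 d)); rewrite -pull_add !addr0. Qed.

Lemma push_zero C A A' (d : Ext (ext E) C A) :
  push (0 : hom A A') d = 0.
Proof. by apply: (addrI (push 0 d)); rewrite -push_add !addr0. Qed.

Lemma pull_idB C A (c : hom C C) (d : Ext (ext E) C A) :
  d = pull c d -> pull (idm C - c) d = 0.
Proof.
by move=> e; apply: (addIr (pull c d)); rewrite -pull_add subrK pull1 add0r.
Qed.

Lemma dsum_pull0 n (Y : 'I_n -> E) X A (i : forall k, hom (Y k) X)
    (p : forall k, hom X (Y k)) (d : Ext (ext E) X A) :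
  \sum_(k < n) i k \oc p k = idm X ->
  (forall k, pull (i k) d = 0) -> d = 0.
Proof.
move=> ip h; rewrite -(pull1 d) -ip.
elim/big_rec: _ => [|k f _ hf]; first exact: pull_zero.
by rewrite pull_add pull_comp h pull0 add0r.
Qed.

Lemma realizes_extend A B C (d : Ext (ext E) C A) (x : hom A B) (y : hom B C)
    T (f : hom A T) :
  realizes d x y -> push f d = 0 <-> exists g : hom B T, g \oc x = f.
Proof. by move=> r; apply: (@realizes_lift (op_extri E) C B A d y x T f r). Qed.

Lemma realizes_coexact A B C (d : Ext (ext E) C A) (x : hom A B) (y : hom B C)
    T (f : hom B T) :
  realizes d x y -> f \oc x = 0 -> exists g : hom C T, g \oc y = f.
Proof. exact: (@realizes_exact (op_extri E) C B A d y x T f). Qed.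

(** Exactness of Hom(U,C) -> E(U,A) -> E(U,B) at E(U,A). *)
Lemma realizes_push0 A B C (d : Ext (ext E) C A) (x : hom A B) (y : hom B C)
    U (z : Ext (ext E) U A) :
  realizes d x y -> push x z = 0 -> exists c : hom U C, z = pull c d.
Proof.
move=> r e; have [D [x1 [y1 [r1 _]]]] := realizes_class z.
have [b eb] := (realizes_extend x r1).1 e.
have [|c [ec _]] := @realizes_ET3 E _ _ _ _ _ _ _ _ _ _ _ _ (idm A) b r1 r.
  by rewrite compm1.
by exists c; rewrite -ec push1.
Qed.

(** Exactness of E(U,K) -> E(U,A) -> E(U,B). By ET4 the class [push f z] has a triangle B -> G -> U;
    as it splits, the class ET4 puts on G can be pulled back along a section. *)
Lemma realizes_push0_mid K A B (s : Ext (ext E) B K) (k : hom K A)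
    (f : hom A B) U (z : Ext (ext E) U A) :
  realizes s k f -> push f z = 0 -> exists e : Ext (ext E) U K, push k e = z.
Proof.
move=> r e0; have [D [x [y [r1 _]]]] := realizes_class z.
have [G [h' [u [v [d'' [_ _ r2 _ e]]]]]] := realizes_ET4 r r1.
have [t et] : exists t, v \oc t = idm U.
  by apply/(realizes_lift _ r2); rewrite e0 pull0.
by exists (pull t d''); rewrite push_pull e -pull_comp et pull1.
Qed.

(** The map (x, f) is the split inflation (1, f) : A -> A + C followed by the inflation x + 1, so
    ET4 applies. *)
Lemma inflation_pair A B D C (d : Ext (ext E) D A) (x : hom A B) (y : hom B D)
    (f : hom A C) (S : biprod B C) :
  realizes d x y ->
  exists (G : E) (z : hom S G), triangle (bp_inl S \oc x + bp_inr S \oc f) z.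
Proof.
move=> r; have [SA] := has_biprod A C; have [Z hZ] := has_zero E.
have [SD] := has_biprod D Z.
(* Shearing the biproduct [SA] by [f] makes (1, f) a biproduct inclusion. *)
pose inl : hom A SA := bp_inl SA + bp_inr SA \oc f.
pose prr : hom SA C := bp_prr SA - f \oc bp_prl SA.
have ll : bp_prl SA \oc inl = idm A.
  by rewrite compDr bp_ll compA bp_lr comp0m addr0.
have rr : prr \oc bp_inr SA = idm C.
  by rewrite compBl bp_rr -compA bp_lr compm0 subr0.
have e : bp_prr SA \oc inl = f.
  by rewrite compDr bp_rl compA bp_rr comp1m add0r.
have rl : prr \oc inl = 0 by rewrite compBl -compA ll compm1 e subrr.
have id1 : inl \oc bp_prl SA + bp_inr SA \oc prr = idm SA.
  by rewrite compBr compDl !compA addrACA subrr addr0 bp_id.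
have r1 := realizes_split (Biprod ll rr (bp_lr SA) rl id1).
have r2 := realizes_sum SA S SD r (zero_triangle_r C hZ).
have [G [h' [u [v [d'' [_ r3 _ _ _]]]]]] := realizes_ET4 r1 r2.
exists G, h', d''; move: r3; congr realizes.
by rewrite /bp_map /= compDl -!compA ll e compm1 comp1m.
Qed.

End Triangles.

Section MoreTriangles.
Variable E : extriCat.
Implicit Types A B C T U X Y Z : E.

Lemma deflation_pair A B D C (d : Ext (ext E) A D) (x : hom D B) (y : hom B A)
    (f : hom C A) (S : biprod B C) :
  realizes d x y ->
  exists (G : E) (z : hom G S), triangle z (y \oc bp_prl S + f \oc bp_prr S).
Proof.
move=> r; have [G [z [d' hd]]] :=
  @inflation_pair (op_extri E) A B D C d y x f (op_biprod S) r.
by exists G, z, d'.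
Qed.

(** Completing the inverse of [c] to a map of triangles reduces to the case [c = 1], where [b]
    differs from the identity by a map of square zero. *)
Lemma triangle_endo_iso A B C (d : Ext (ext E) C A) (x : hom A B) (y : hom B C)
    (b : hom B B) (c : hom C C) :
  realizes d x y -> b \oc x = x -> y \oc b = c \oc y -> pull c d = d ->
  is_iso c -> is_iso b.
Proof.
move=> r bx yb cd [c' [c1 c2]].
have [|b' [b'x yb']] := @realizes_map E _ _ _ _ _ _ _ _ _ _ _ _ (idm A) c' r r.
  by rewrite push1 -[in RHS]cd -pull_comp c2 pull1.
rewrite compm1 in b'x.
have unip (t : hom B B) : t \oc x = x -> y \oc t = y -> is_iso t.
  move=> tx yt; pose n := t - idm B.
  have [l el] : exists l, l \oc y = n.
    by apply: (realizes_coexact r); rewrite compBl tx comp1m subrr.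
  have nn : n \oc n = 0.
    by rewrite -{1}el -compA compBr yt compm1 subrr compm0.
  have -> : t = idm B + n by rewrite addrC subrK.
  exists (idm B - n); split.
    by rewrite compDr compm1 compBl comp1m nn subr0 subrK.
  by rewrite compDl comp1m compBr compm1 nn subr0 subrK.
apply: (two_sided_iso (g := b') (h := b')).
  by apply: unip; rewrite -?compA ?b'x // compA yb -compA yb' compA c2 comp1m.
by apply: unip; rewrite -?compA ?bx // compA yb' -compA yb compA c1 comp1m.
Qed.

(** An endomorphism fixing [x] induces some [c] on C with [pull c d = d]. If [1 - c] were
    invertible, [d] would vanish; hence [c] is invertible. *)
Lemma left_minimal_local A B C (d : Ext (ext E) C A) (x : hom A B)
    (y : hom B C) :
  local_End C -> realizes d x y -> d <> 0 -> left_minimal x.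
Proof.
move=> lC r nd phi e.
have [|c [cd cy]] := @realizes_ET3 E _ _ _ _ _ _ _ _ _ _ _ _ (idm A) phi r r.
  by rewrite compm1.
rewrite push1 in cd; apply: (triangle_endo_iso r e (esym cy) (esym cd)).
have [//|[g [_ g2]]] := local_iso lC c.
by case: nd; rewrite -(pull1 d) -g2 pull_comp pull_idB // pull0.
Qed.

End MoreTriangles.

(** * Weak kernels and cokernels modulo a subcategory *)

Section ModuloSubcategory.
Variables (K : preaddCat) (W : K -> Prop).
Implicit Types A B C T X Y Z : K.

Definition mmono A B (f : hom A B) : Prop :=
  forall T (t : hom T A),
  factors_through W (f \oc t) -> factors_through W t.

Definition mepi A B (f : hom A B) : Prop :=
  forall T (t : hom B T),
  factors_through W (t \oc f) -> factors_through W t.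

Definition wker A B C (k : hom A B) (f : hom B C) : Prop :=
  factors_through W (f \oc k) /\
  forall T (x : hom T B), factors_through W (f \oc x) ->
    exists u : hom T A, factors_through W (x - k \oc u).

Definition wcoker A B C (c : hom B C) (f : hom A B) : Prop :=
  factors_through W (c \oc f) /\
  forall T (x : hom B T), factors_through W (x \oc f) ->
    exists u : hom C T, factors_through W (x - u \oc c).

(** In E/W: every monomorphism is a kernel of its cokernel. It is phrased with representatives, for
    every weak cokernel of [m]. *)
Definition normal_monos : Prop :=
  forall A B C (m : hom A B) (c : hom B C), mmono m -> wcoker c m ->
  forall T (x : hom T B), factors_through W (c \oc x) ->
    exists s : hom T A, factors_through W (x - m \oc s).

Definition normal_epis : Prop :=
  forall A B C (k : hom A B) (f : hom B C), mepi f -> wker k f ->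
  forall T (x : hom B T), factors_through W (x \oc k) ->
    exists s : hom C T, factors_through W (x - s \oc f).

End ModuloSubcategory.

Section OppositeModulo.
Variables (K : preaddCat) (W : K -> Prop).
Implicit Types A B C : K.
Let Kop := op_preadd K.

Lemma op_factors A B (f : hom A B) :
  @factors_through Kop W B A f <-> factors_through W f.
Proof.
by split=> -[C [WC [g [h ->]]]]; exists C; split=> //; exists h, g.
Qed.

Lemma op_mepi A B (f : hom A B) : @mepi Kop W B A f <-> mmono W f.
Proof. by split=> h T t /op_factors /h /op_factors. Qed.

Lemma op_mmono A B (f : hom A B) : @mmono Kop W B A f <-> mepi W f.
Proof. by split=> h T t /op_factors /h /op_factors. Qed.

Lemma op_wcoker A B C (k : hom A B) (f : hom B C) :
  @wcoker Kop W C B A k f <-> wker W k f.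
Proof.
split=> -[/op_factors h1 h2]; split=> // T x /op_factors /h2 [u /op_factors hu];
by exists u.
Qed.

Lemma op_wker A B C (c : hom B C) (f : hom A B) :
  @wker Kop W C B A c f <-> wcoker W c f.
Proof.
split=> -[/op_factors h1 h2]; split=> // T x /op_factors /h2 [u /op_factors hu];
by exists u.
Qed.

Lemma op_normal_monos : @normal_monos Kop W <-> normal_epis W.
Proof.
split=> h A B C m c.
  move=> /op_mmono h1 /op_wcoker h2 T x /op_factors h3.
  by have [s /op_factors] := h _ _ _ _ _ h1 h2 _ _ h3; exists s.
move=> h1 h2 T x /op_factors h3.
have h1' : mepi W (m : @hom K B A) by apply/op_mmono.
have h2' : wker W (c : @hom K C B) (m : @hom K B A) by apply/op_wcoker.
by have [s hs] := h _ _ _ _ _ h1' h2' _ _ h3; exists s; apply/op_factors.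
Qed.

Lemma op_normal_epis : @normal_epis Kop W <-> normal_monos W.
Proof.
split=> h A B C m c.
  move=> /op_mepi h1 /op_wker h2 T x /op_factors h3.
  by have [s /op_factors] := h _ _ _ _ _ h1 h2 _ _ h3; exists s.
move=> h1 h2 T x /op_factors h3.
have h1' : mmono W (c : @hom K C B) by apply/op_mepi.
have h2' : wcoker W (m : @hom K B A) (c : @hom K C B) by apply/op_wker.
by have [s hs] := h _ _ _ _ _ h1' h2' _ _ h3; exists s; apply/op_factors.
Qed.

End OppositeModulo.

(** * The ideal of morphisms that vanish in the quotient *)

Section IdealFacts.
Variables (K : addCat) (W : K -> Prop).
Hypothesis hA : additive_subcat W.
Implicit Types A B C T X Y Z : K.
Notation nul := (factors_through W).

Lemma nul0 A B : nul (0 : hom A B).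
Proof. by have [/asboolP] := ideal_closed hA A B. Qed.

Lemma nulB A B (f g : hom A B) : nul f -> nul g -> nul (f - g).
Proof.
move=> hf hg; have [_ h] := ideal_closed hA A B.
by apply/asboolP; apply: h; apply/asboolP.
Qed.

Lemma nulN A B (f : hom A B) : nul f -> nul (- f).
Proof. by move=> h; rewrite -sub0r; apply: nulB => //; apply: nul0. Qed.

Lemma nulD A B (f g : hom A B) : nul f -> nul g -> nul (f + g).
Proof. by move=> hf /nulN hg; rewrite -[g]opprK; apply: nulB. Qed.

Lemma nul_cancel A B (f g : hom A B) : nul (f - g) -> nul g -> nul f.
Proof. by move=> h1 h2; rewrite -(subrK g f); apply: nulD. Qed.

Lemma nul_compl A B C (g : hom B C) (f : hom A B) : nul f -> nul (g \oc f).
Proof.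
move=> [X [WX [u [v ->]]]]; exists X; split=> //; exists (g \oc u), v.
by rewrite compA.
Qed.

Lemma nul_compr A B C (g : hom B C) (f : hom A B) : nul g -> nul (g \oc f).
Proof.
move=> [X [WX [u [v ->]]]]; exists X; split=> //; exists u, (v \oc f).
by rewrite compA.
Qed.

Lemma nul_src A B (f : hom A B) : W A -> nul f.
Proof.
by move=> WA; exists A; split=> //; exists f, (idm A); rewrite compm1.
Qed.

Lemma nul_tgt A B (f : hom A B) : W B -> nul f.
Proof.
by move=> WB; exists B; split=> //; exists (idm B), f; rewrite comp1m.
Qed.

Lemma mmono_comp A B C (g : hom B C) (f : hom A B) :
  mmono W g -> mmono W f -> mmono W (g \oc f).
Proof. by move=> hg hf T t; rewrite -compA => /hg /hf. Qed.

End IdealFacts.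

(** Objects vanishing in the quotient lie in [W]. The identity of a local summand of A is a sum of
    maps through the local summands of an object V of [W]; one term is invertible, and that summand
    of V is isomorphic to the one of A. *)
Lemma nul_id_closed (K : addCat) (W : K -> Prop) (A : K) :
  krull_schmidt K -> closed_under_sums W -> closed_under_summands W ->
  factors_through W (idm A) -> W A.
Proof.
move=> KS Wsum Wsd [V [WV [q [p e]]]].
have [n [Y [lY hY]]] := KS A; have [m [X [lX hX]]] := KS V.
apply: (closed_dsum Wsum Wsd (ex_intro _ V WV) hY) => k.
have [i [r [ri _ _]]] := hY; have [j [s [_ _ sj]]] := hX.
have e1 : \sum_(l < m) (r k \oc q \oc j l) \oc (s l \oc p \oc i k) = idm (Y k).
  rewrite -ri.
  transitivity (r k \oc q \oc (\sum_(l < m) j l \oc s l) \oc (p \oc i k)).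
    rewrite comp_sumr comp_suml; apply: eq_bigr => l _.
    by rewrite !compA.
  by rewrite sj compm1 -!compA (compA q) -e comp1m.
have [l [u [u1 u2]]] := local_sum_iso (lY k) e1.
set f := r k \oc q \oc j l in u1 u2; set g := s l \oc p \oc i k in u1 u2.
clearbody f g.
have WX : W (X l) by apply: Wsd WV; apply: dsum_summand hX.
apply: closed_iso Wsd _ _ _ WX.
(* Since [u f] is a left inverse of [g], the map [1 - g u f] kills [g]; were it invertible, [g]
   would be zero. *)
exists g; have [h|[v [v1 _]]] := local_iso (lX l) (g \oc (u \oc f)).
  apply: (two_sided_iso (g := u \oc f) (h := u \oc f)) => //.
  by rewrite -compA u1; apply: is_iso_id.
have gug : (idm (X l) - g \oc (u \oc f)) \oc g = 0.
  by rewrite compBl comp1m -!compA u1 compm1 subrr.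
have g0 : g = 0 by rewrite -(comp1m g) -v1 -compA gug compm0.
case: (lY k) => + _; case; rewrite -u1 g0 !compm0 //.
Qed.

(** * Kernels and cokernels modulo a hereditary-like subcategory *)

Section Hereditary.
Variables (E : extriCat) (W : E -> Prop).
Hypothesis hW : hereditary_like W.
Implicit Types A B C T U V X Y Z : E.
Notation nul := (factors_through W).
Let hA := hereditary_like_additive hW.

(** The classes whose triangles have a W-monic first map, described without choosing a triangle so
    that [push] and [pull] visibly preserve them. *)
Definition wclass C A (d : Ext (ext E) C A) : Prop :=
  forall V, W V -> forall t : hom A V, push t d = 0.

Lemma wclass_monic A B C (d : Ext (ext E) C A) (x : hom A B) (y : hom B C) :
  realizes d x y -> wclass d <-> Wmonic W x.
Proof.
move=> r; split=> h V WV t.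
  by apply/(realizes_extend t r); apply: h.
by apply/(realizes_extend t r); apply: h.
Qed.

Lemma wclass_push C A B (d : Ext (ext E) C A) (f : hom A B) :
  wclass d -> wclass (push f d).
Proof. by move=> h V WV t; rewrite -push_comp; apply: h. Qed.

Lemma wclass_pull C C' A (d : Ext (ext E) C A) (f : hom C' C) :
  wclass d -> wclass (pull f d).
Proof. by move=> h V WV t; rewrite push_pull h // pull0. Qed.

Lemma wclass_nul C A B (d : Ext (ext E) C A) (f : hom A B) :
  wclass d -> nul f -> push f d = 0.
Proof.
by move=> h [V [WV [u [v ->]]]]; rewrite push_comp h // push0.
Qed.

Lemma monic_nul A B (x : hom A B) T (f : hom A T) :
  Wmonic W x -> nul f -> exists g : hom B T, g \oc x = f /\ nul g.
Proof.
move=> h [V [WV [u [v ->]]]]; have [v' ev] := h V WV v.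
exists (u \oc v'); split; first by rewrite -compA ev.
by exists V; split=> //; exists u, v'.
Qed.

Lemma epic_nul A B (x : hom A B) T (f : hom T B) :
  Wepic W x -> nul f -> exists g : hom T A, x \oc g = f /\ nul g.
Proof.
move=> h [V [WV [u [v ->]]]]; have [u' eu] := h V WV u.
exists (u' \oc v); split; first by rewrite compA eu.
by exists V; split=> //; exists u', v.
Qed.

(** Let [h g] be null and W2 -> W1 -> X a right approximation triangle. The obstruction to lifting
    [h] to W1 is pushed out from [d] along a map A -> W2; this map extends over the W-monic [f], so
    the obstruction vanishes. *)
Lemma triangle_mepi A B C (d : Ext (ext E) C A) (f : hom A B) (g : hom B C) :
  realizes d f g -> Wmonic W f -> mepi W g.
Proof.
move=> r hf X h [V [WV [p [q e]]]].
have [W2 [W1 [i [w [[d' r'] WW1 WW2 [_ ew]]]]]] := hl_right hW X.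
have [p' ep] := ew V WV p.
have [|a [ea _]] := @realizes_ET3op E _ _ _ _ _ _ _ _ _ _ _ _ (p' \oc q) h r r'.
  by rewrite e compA ep.
have [a' ea'] := hf W2 WW2 a.
have [|h' <-] := (realizes_lift h r').1 _.
  by rewrite -ea -ea' push_comp (realizes_push_l r) push0.
by exists W1; split=> //; exists w, h'.
Qed.

Lemma triangle_wcoker A B C (d : Ext (ext E) C A) (f : hom A B) (g : hom B C) :
  realizes d f g -> Wmonic W f -> wcoker W g f.
Proof.
move=> r hf; split=> [|X h hn].
  by rewrite (realizes_comp0 r); apply: nul0.
have [h' [e hn']] := monic_nul hf hn.
have [|l el] := @realizes_coexact _ _ _ _ _ _ _ _ (h - h') r.
  by rewrite compBl e subrr.
by exists l; rewrite el opprB addrC subrK.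
Qed.

(** Adding a left approximation as a second component turns [f] into a W-monic inflation A -> W1 +
    B, unchanged modulo [W]; its cone is the cokernel. *)
Lemma mod_coker A B (f : hom A B) :
  exists (C : E) (c : hom B C), wcoker W c f /\ mepi W c.
Proof.
have [W1 [W2 [w [p [[d r] WW1 WW2 [_ mw]]]]]] := hl_left hW A.
have [S] := has_biprod W1 B.
have [G [z [d' r']]] := inflation_pair f S r.
set x := _ + _ in r'.
have mx : Wmonic W x.
  move=> V WV t; have [t' <-] := mw V WV t.
  exists (t' \oc bp_prl S); rewrite -compA; congr (_ \oc _).
  exact: bp_pair_prl.
have [h1 h2] := triangle_wcoker r' mx; have h3 := triangle_mepi r' mx.
have zx : z \oc bp_inr S \oc f = - (z \oc bp_inl S \oc w).
  apply/eqP; rewrite -subr_eq0 opprK addrC -!compA -compDr.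
  by rewrite (realizes_comp0 r').
exists G, (z \oc bp_inr S); split; first split.
- by rewrite zx; apply: nulN => //; apply: nul_compl => //; apply: nul_tgt.
- move=> T h hn; have [|l hl] := h2 T (h \oc bp_prr S).
    by rewrite -compA bp_pair_prr.
  exists l; have := nul_compr (bp_inr S) hl.
  by rewrite compBl -!compA bp_rr compm1.
- move=> T t hn; apply: h3.
  rewrite -(compm1 (t \oc z)) -(bp_id S) compDr.
  apply: nulD => //; rewrite compA; apply: nul_compr; last by rewrite -compA.
  exact: nul_src.
Qed.

End Hereditary.

Section HereditaryDual.
Variables (E : extriCat) (W : E -> Prop).
Hypothesis hW : hereditary_like W.
Implicit Types A B C T U V X Y Z : E.
Let hWop := op_hereditary_like hW.

Lemma triangle_mmono A B C (d : Ext (ext E) C A) (f : hom A B) (g : hom B C) :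
  realizes d f g -> Wepic W g -> mmono W f.
Proof.
move=> r h; apply/op_mepi.
exact: (@triangle_mepi (op_extri E) W hWop C B A d g f r h).
Qed.

Lemma triangle_wker A B C (d : Ext (ext E) C A) (f : hom A B) (g : hom B C) :
  realizes d f g -> Wepic W g -> wker W f g.
Proof.
move=> r h; apply/op_wcoker.
exact: (@triangle_wcoker (op_extri E) W hWop C B A d g f r h).
Qed.

Lemma mod_ker A B (f : hom A B) :
  exists (C : E) (c : hom C A), wker W c f /\ mmono W c.
Proof.
have [C [c [/op_wcoker h1 /op_mepi h2]]] :=
  @mod_coker (op_extri E) W hWop B A f.
by exists C, c.
Qed.

End HereditaryDual.

(** * Translation between morphisms modulo [W] and the quotient category *)

Section Quotient.
Variables (K : addCat) (W : K -> Prop).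
Hypothesis hA : additive_subcat W.
Implicit Types A B C T X Y Z : K.
Notation nul := (factors_through W).
Notation Q := (ideal_quotient hA).
Notation pi f := (qpi hA f : @hom Q _ _).

Lemma qpi_nul A B (f : hom A B) : pi f = 0 <-> nul f.
Proof. by rewrite -(qpi0 hA A B) qpi_eq subr0. Qed.

Lemma qpi_surj A B (f : @hom Q A B) : exists g : @hom K A B, f = pi g.
Proof. by exists (qrepr f); symmetry; apply: qreprK. Qed.

Lemma qpiM A B C (g : hom B C) (f : hom A B) : pi (g \oc f) = pi g \oc pi f.
Proof. exact: qpi_comp. Qed.

Lemma qpi_sub A B (f g : hom A B) : pi (f - g) = pi f - pi g.
Proof. exact: raddfB. Qed.

Lemma qpi1 A : pi (idm A) = idm (A : Q).
Proof. by []. Qed.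

Lemma qpi_mono0 A B (f : hom A B) : mono0 (pi f) <-> mmono W f.
Proof.
split=> h T t.
  move=> /qpi_nul e; apply/qpi_nul; apply: h; rewrite -e; symmetry; exact: qpiM.
have [{}t ->] := qpi_surj t; rewrite -qpiM => /qpi_nul /h ?; exact/qpi_nul.
Qed.

Lemma qpi_epi0 A B (f : hom A B) : epi0 (pi f) <-> mepi W f.
Proof.
split=> h T t.
  move=> /qpi_nul e; apply/qpi_nul; apply: h; rewrite -e; symmetry; exact: qpiM.
have [{}t ->] := qpi_surj t; rewrite -qpiM => /qpi_nul /h ?; exact/qpi_nul.
Qed.

Lemma wker_kernel A B C (k : hom A B) (f : hom B C) :
  wker W k f -> mmono W k -> is_kernel (pi k) (pi f).
Proof.
move=> [h1 h2] /qpi_mono0 /is_monoP mk; split.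
  by rewrite -qpiM; apply/qpi_nul.
move=> X g; have [{}g ->] := qpi_surj g; rewrite -qpiM => /qpi_nul /h2 [u hu].
have e : pi k \oc pi u = pi g by rewrite -qpiM; symmetry; apply/qpi_eq.
by exists (pi u); split=> // v ev; apply: mk; rewrite e ev.
Qed.

Lemma kernel_wker A B C (k : hom A B) (f : hom B C) :
  is_kernel (pi k) (pi f) -> wker W k f.
Proof.
move=> [h1 h2]; split; first by apply/qpi_nul; rewrite qpiM.
move=> X g /qpi_nul; rewrite qpiM => /h2 [u [e _]]; move: e.
have [{}u ->] := qpi_surj u; rewrite -qpiM => e.
by exists u; apply/qpi_eq; symmetry.
Qed.

Lemma wcoker_cokernel A B C (c : hom B C) (f : hom A B) :
  wcoker W c f -> mepi W c -> is_cokernel (pi c) (pi f).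
Proof.
move=> [h1 h2] /qpi_epi0 /is_epiP ec; split.
  by rewrite -qpiM; apply/qpi_nul.
move=> X g; have [{}g ->] := qpi_surj g; rewrite -qpiM => /qpi_nul /h2 [u hu].
have e : pi u \oc pi c = pi g by rewrite -qpiM; symmetry; apply/qpi_eq.
by exists (pi u); split=> // v ev; apply: ec; rewrite e ev.
Qed.

Lemma cokernel_wcoker A B C (c : hom B C) (f : hom A B) :
  is_cokernel (pi c) (pi f) -> wcoker W c f.
Proof.
move=> [h1 h2]; split; first by apply/qpi_nul; rewrite qpiM.
move=> X g /qpi_nul; rewrite qpiM => /h2 [u [e _]]; move: e.
have [{}u ->] := qpi_surj u; rewrite -qpiM => e.
by exists u; apply/qpi_eq; symmetry.
Qed.

End Quotient.

Section AbelianQuotient.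
Variables (E : extriCat) (W : E -> Prop).
Hypothesis hW : hereditary_like W.
Variable hA : additive_subcat W.
Notation nul := (factors_through W).
Notation Q := (ideal_quotient hA).
Notation pi f := (qpi hA f : @hom Q _ _).

(** [mod_ker] and [mod_coker] already provide kernels and cokernels, so only normality is at
    stake. *)
Lemma abelian_normal : abelian Q <-> normal_monos W /\ normal_epis W.
Proof.
split=> [[_ _ hm he]|[hm he]]; split.
- move=> A B C m c /(qpi_mono0 hA) /is_monoP /hm [X [g hg]] [cm hc] T x cx.
  have [g' eg] := qpi_surj g; rewrite eg in hg.
  have [gm h] := kernel_wker hg; have [u hu] := hc _ _ gm.
  apply: h; apply: (nul_cancel hA (g := u \oc c \oc x)).
    by rewrite -compBl; apply: nul_compr.
  by rewrite -compA; apply: nul_compl.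
- move=> A B C k f /(qpi_epi0 hA) /is_epiP /he [X [g hg]] [fk hk] T x xk.
  have [g' eg] := qpi_surj g; rewrite eg in hg.
  have [gm h] := cokernel_wcoker hg; have [u hu] := hk _ _ gm.
  apply: h; apply: (nul_cancel hA (g := x \oc (k \oc u))).
    by rewrite -compBr; apply: nul_compl.
  by rewrite compA; apply: nul_compr.
- move=> A B f; have [{}f ->] := qpi_surj f.
  by have [C [c [h1 h2]]] := mod_ker hW f; exists C, (pi c); apply: wker_kernel.
- move=> A B f; have [{}f ->] := qpi_surj f.
  have [C [c [h1 h2]]] := mod_coker hW f.
  by exists C, (pi c); apply: wcoker_cokernel.
- move=> A B f; have [{}f ->] := qpi_surj f => /is_monoP /qpi_mono0 mf.
  have [C [c [h1 h2]]] := mod_coker hW f; exists C, (pi c).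
  apply: wker_kernel => //; split; first by case: h1.
  exact: hm.
- move=> A B f; have [{}f ->] := qpi_surj f => /is_epiP /qpi_epi0 ef.
  have [C [c [h1 h2]]] := mod_ker hW f; exists C, (pi c).
  apply: wcoker_cokernel => //; split; first by case: h1.
  exact: he.
Qed.

End AbelianQuotient.

(** * Rigidity implies that the quotient is abelian *)

Section Rigid.
Variables (E : extriCat) (W : E -> Prop).
Hypotheses (KS : krull_schmidt E) (hW : hereditary_like W).
Hypothesis rigid : forall X Y : E, W X -> W Y ->
  forall d : Ext (ext E) X Y, d = 0.
Notation nul := (factors_through W).
Let hA := hereditary_like_additive hW.

(** Completing [m] by a right approximation gives a deflation W1 + A -> B whose kernel K lies in
    [W]. A class killed by [m] then comes from E(V, K), which is zero. *)
Lemma rigid_push_inj A B (m : hom A B) V (z : Ext (ext E) V A) :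
  mmono W m -> W V -> push m z = 0 -> z = 0.
Proof.
move=> mm WV e0.
have [W2 [W1 [i [w [[d r] WW1 WW2 [_ ew]]]]]] := hl_right hW B.
have [S] := has_biprod W1 A.
have [K [k [d' r']]] := deflation_pair m S r.
set x := _ + _ in r'.
have ex : Wepic W x.
  move=> V' WV' t; have [t' <-] := ew V' WV' t.
  by exists (bp_inl S \oc t'); rewrite compA bp_copair_inl.
(* The A-component of [k] is null because [m] is monic modulo [W], and the other component ends in
   W1. So [k] is null, and as [k] is itself monic modulo [W], so is the identity of K. *)
have WK : W K.
  apply: (nul_id_closed KS (hl_sums hW) (hl_summands hW)).
  apply: (triangle_mmono hW r' ex); rewrite compm1 (bp_in_dec k).
  apply: (nulD hA); first by apply: nul_compl; apply: nul_tgt.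
  apply: nul_compl; apply: mm.
  have := realizes_comp0 r'; rewrite /x compDl -!compA => /eqP.
  rewrite addrC addr_eq0 => /eqP ->; apply: (nulN hA).
  by apply: nul_compl; apply: nul_tgt.
have [|e ee] := @realizes_push0_mid _ _ _ _ _ _ _ _ (push (bp_inr S) z) r'.
  by rewrite -push_comp bp_copair_inr.
by rewrite -(push1 z) -(bp_rr S) push_comp -ee (rigid WV WK e) !push0.
Qed.

Lemma rigid_normal_monos : normal_monos W.
Proof.
move=> A B C m c mm [cm hc] T x cx.
have [W1 [W2 [w [p [[d r] WW1 WW2 [_ mw]]]]]] := hl_left hW A.
have [S] := has_biprod W1 B.
have [G [z [d' r']]] := inflation_pair m S r.
set y := _ + _ in r'.
have zm : z \oc bp_inr S \oc m = - (z \oc bp_inl S \oc w).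
  apply/eqP; rewrite -subr_eq0 opprK addrC -!compA -compDr.
  by rewrite (realizes_comp0 r').
have [|l hl] := hc _ (z \oc bp_inr S).
  by rewrite zm; apply: (nulN hA); apply: nul_compl; apply: nul_tgt.
have [V [WV [u [v e]]]] : nul (z \oc bp_inr S \oc x).
  apply: (nul_cancel hA (g := l \oc c \oc x)).
    by rewrite -compBl; apply: nul_compr.
  by rewrite -compA; apply: nul_compl.
have my : mmono W y.
  move=> X t /(nul_compl (bp_prr S)).
  by rewrite compA bp_pair_prr => /mm.
(* The obstruction [pull u d'] is killed by [push y], and [y] is monic modulo [W]. *)
have [u' eu] : exists u', z \oc u' = u.
  apply/(realizes_lift u r'); apply: (rigid_push_inj my WV).
  by rewrite push_pull (realizes_push_l r') pull0.
have [|s es] := @realizes_exact _ _ _ _ _ _ _ _ (bp_inr S \oc x - u' \oc v) r'.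
  by rewrite compBr !compA eu e subrr.
exists s; have := congr1 (fun f => bp_prr S \oc f) es.
rewrite compA bp_pair_prr compBr compA bp_rr comp1m => ->.
rewrite opprB addrC subrK; apply: nul_compl.
by exists V; split=> //; exists u', v.
Qed.

End Rigid.

Lemma rigid_abelian (E : extriCat) (W : E -> Prop) (hA : additive_subcat W) :
  krull_schmidt E -> cluster_tilting W -> abelian (ideal_quotient hA).
Proof.
move=> KS [hW rig]; apply/(abelian_normal hW); split.
  exact: rigid_normal_monos.
apply/op_normal_monos.
apply: (@rigid_normal_monos (op_extri E) W (op_krull_schmidt KS)
  (op_hereditary_like hW)) => X Y WX WY d.
exact: rig.
Qed.

(** * Local and uniform objects of an abelian category *)

Lemma dependent_sequence (S : Type) (R : S -> S -> Prop) (s0 : S) :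
  (forall s, exists s', R s s') ->
  exists f : nat -> S, f 0%N = s0 /\ forall n, R (f n) (f n.+1).
Proof.
by move=> /choice [g hg]; exists (fun n => iter n g s0).
Qed.

Section AbelianCategory.
Variable K : addCat.
Implicit Types A B C D T V X Y Z : K.

Definition jointly_epi A B X (f : hom A X) (g : hom B X) : Prop :=
  forall T (t : hom X T), t \oc f = 0 -> t \oc g = 0 -> t = 0.

Definition jointly_mono A B X (f : hom X A) (g : hom X B) : Prop :=
  forall T (t : hom T X), f \oc t = 0 -> g \oc t = 0 -> t = 0.

(** Also called hollow: two proper subobjects never span X. A zero object qualifies, hence the
    separate nonzero hypotheses later. *)
Definition local_obj X : Prop :=
  forall A B (f : hom A X) (g : hom B X),
  jointly_epi f g -> epi0 f \/ epi0 g.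

Definition uniform_obj X : Prop :=
  forall A B (f : hom X A) (g : hom X B),
  jointly_mono f g -> mono0 f \/ mono0 g.

Lemma local_indecomposable X : local_obj X -> ~ is_zero X -> indecomposable X.
Proof.
move=> lX nX; split=> // Y Z S [f [g [e1 e2]]].
have [T t h1 h2|h|h] := lX _ _ (f \oc bp_inl S) (f \oc bp_inr S).
- rewrite -(compm1 t) -e2 compA; have -> : t \oc f = 0; last exact: comp0m.
  by apply: (bp_ext_out (S := S)); rewrite -compA ?h1 ?h2 comp0m.
- right; apply/is_zeroP; rewrite -(bp_rr S).
  have /h e : (bp_prr S \oc g) \oc (f \oc bp_inl S) = 0.
    by rewrite -compA (compA g) e1 comp1m bp_rl.
  by rewrite -(compm1 (bp_prr S)) -e1 compA e !comp0m.
- left; apply/is_zeroP; rewrite -(bp_ll S).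
  have /h e : (bp_prl S \oc g) \oc (f \oc bp_inr S) = 0.
    by rewrite -compA (compA g) e1 comp1m bp_lr.
  by rewrite -(compm1 (bp_prl S)) -e1 compA e !comp0m.
Qed.

(** The map out of the direct sum of the [L j] is epic; induction on n peels off one summand, and
    the empty sum is excluded because X is nonzero. *)
Lemma local_family X n (L : 'I_n -> K) (f : forall j, hom (L j) X) :
  local_obj X -> ~ is_zero X ->
  (forall T (t : hom X T), (forall j, t \oc f j = 0) -> t = 0) ->
  exists j, epi0 (f j).
Proof.
move=> lX nX hf.
suff [R [g [hg]]] : exists R (g : hom R X),
    (forall T (t : hom X T), t \oc g = 0 -> forall j, t \oc f j = 0) /\
    (epi0 g -> exists j, epi0 (f j)).
  by apply=> T t /hg /hf.
elim: n L f {hf} => [|n IHn] L f.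
  have [Z _] := has_zero K; exists Z, 0; split=> [T t _ []//|h].
  by case: nX; apply/is_zeroP; apply: h; apply: compm0.
have [R [g [hg1 hg2]]] := IHn _ (fun j => f (lift ord0 j)).
have [S] := has_biprod (L ord0) R.
exists S, (f ord0 \oc bp_prl S + g \oc bp_prr S); split=> [T t e j|h].
  have e0 : t \oc f ord0 = 0.
    by rewrite -[f ord0](bp_copair_inl S (f ord0) g) compA e comp0m.
  have e1 : t \oc g = 0.
    by rewrite -[g](bp_copair_inr S (f ord0) g) compA e comp0m.
  by case: (unliftP ord0 j) => [k ->|-> //]; apply: hg1.
have [T t e0 e1|h0|/hg2 [j hj]] := lX _ _ (f ord0) g.
- by apply: h; rewrite compDr !compA e0 e1 !comp0m addr0.
- by exists ord0.
- by exists (lift ord0 j).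
Qed.

Hypothesis hab : abelian K.

Lemma kernel_exists A B (f : hom A B) : exists X (k : hom X A),
  [/\ f \oc k = 0, mono0 k
    & forall T (g : hom T A), f \oc g = 0 -> exists u, k \oc u = g].
Proof.
have [+ _ _ _] := hab => /(_ A B f) [X [k [fk hk]]]; exists X, k; split=> //.
  move=> T t kt; have [|u [_ hu]] := hk T 0; first exact: compm0.
  by rewrite -(hu t kt) (hu 0 (compm0 _ _)).
by move=> T g /hk [u [e _]]; exists u.
Qed.

Lemma cokernel_exists A B (f : hom A B) : exists X (c : hom B X),
  [/\ c \oc f = 0, epi0 c
    & forall T (g : hom B T), g \oc f = 0 -> exists u, u \oc c = g].
Proof.
have [_ + _ _] := hab => /(_ A B f) [X [k [fk hk]]]; exists X, k; split=> //.
  move=> T t kt; have [|u [_ hu]] := hk T 0; first exact: comp0m.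
  by rewrite -(hu t kt) (hu 0 (comp0m _ _)).
by move=> T g /hk [u [e _]]; exists u.
Qed.

Lemma epi_factor A B (f : hom A B) T (t : hom A T) : epi0 f ->
  (forall X (x : hom X A), f \oc x = 0 -> t \oc x = 0) ->
  exists s, s \oc f = t.
Proof.
move=> /is_epiP ef h; have [_ _ _ +] := hab.
by move=> /(_ A B f ef) [X [g [fg /(_ T t (h _ _ fg)) [u [e _]]]]]; exists u.
Qed.

Lemma mono_factor A B (f : hom A B) T (t : hom T B) : mono0 f ->
  (forall X (x : hom B X), x \oc f = 0 -> x \oc t = 0) ->
  exists s, f \oc s = t.
Proof.
move=> /is_monoP ef h; have [_ _ + _] := hab.
by move=> /(_ A B f ef) [X [g [fg /(_ T t (h _ _ fg)) [u [e _]]]]]; exists u.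
Qed.

Lemma mono_epi_iso A B (f : hom A B) : mono0 f -> epi0 f -> is_iso f.
Proof.
move=> mf ef; have [|s es] := @mono_factor _ _ f _ (idm B) mf.
  by move=> X x /ef ->; rewrite comp0m.
exists s; split=> //; apply/eqP; rewrite -subr_eq0; apply/eqP/mf.
by rewrite compBr compA es comp1m compm1 subrr.
Qed.

(** The pullback Y is the kernel of (h, -i) on A + B. This map is epic because [h] is, so a map out
    of B killing [p] factors through it, with a factor killing [h], hence zero. *)
Lemma pullback_epi A B D (h : hom A D) (i : hom B D) : epi0 h ->
  exists Y (q : hom Y A) (p : hom Y B),
    [/\ h \oc q = i \oc p, epi0 p, mono0 i -> mono0 q
      & forall T (a : hom T A) (b : hom T B), h \oc a = i \oc b ->
          exists u, q \oc u = a /\ p \oc u = b].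
Proof.
move=> eh; have [S] := has_biprod A B.
pose f := h \oc bp_prl S + (- i) \oc bp_prr S.
have [Y [k [fk mk hk]]] := kernel_exists f.
have e : h \oc (bp_prl S \oc k) = i \oc (bp_prr S \oc k).
  by apply/eqP; rewrite -subr_eq0 -compNl !compA -compDl fk.
exists Y, (bp_prl S \oc k), (bp_prr S \oc k); split=> //.
- move=> T t et.
  have ef : epi0 f.
    by move=> V v ev; apply: eh;
       rewrite -[h](bp_copair_inl S h (- i)) compA ev comp0m.
  have [|s es] := @epi_factor _ _ f _ (t \oc bp_prr S) ef.
    move=> X x /hk [u <-].
    transitivity (t \oc (bp_prr S \oc k) \oc u); first by rewrite !compA.
    by rewrite et comp0m.
  have s0 : s = 0.
    apply: eh; rewrite -[h](bp_copair_inl S h (- i)) compA es -compA.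
    by rewrite bp_rl compm0.
  by rewrite -(compm1 t) -(bp_rr S) compA -es s0 !comp0m.
- move=> mi T t et; apply: mk; apply: (bp_ext_in (S := S)).
    by rewrite compm0 compA.
  by rewrite compm0 compA; apply: mi; rewrite compA -e -compA et compm0.
- move=> T a b eab.
  have [|u eu] := hk _ (bp_inl S \oc a + bp_inr S \oc b).
    by rewrite compDl -!compA bp_pair_prl bp_pair_prr compNl eab subrr.
  by exists u; rewrite -!compA eu bp_pair_prl bp_pair_prr.
Qed.

(** The image is the kernel of the cokernel. If [t] kills [e], then [f] factors through the kernel
    of [t], which is therefore all of X. *)
Lemma image_exists A B (f : hom A B) :
  exists X (m : hom X B) (e : hom A X), [/\ mono0 m, epi0 e & m \oc e = f].
Proof.
have [C [c [cf _ hc]]] := cokernel_exists f.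
have [X [m [cm mm hm]]] := kernel_exists c.
have [e ee] := hm _ f cf; exists X, m, e; split=> // T t te.
have [Y [k [tk mk hk]]] := kernel_exists t.
have [e' ee'] := hk _ e te.
have [|s es] := @mono_factor _ _ (m \oc k) _ m (mono0_comp mm mk).
  move=> Z x xmk; have [|u <-] := hc _ x; last by rewrite -compA cm compm0.
  by rewrite -ee -ee' !compA -(compA x) xmk comp0m.
have ks : k \oc s = idm X.
  by apply/eqP; rewrite -subr_eq0; apply/eqP/mm;
     rewrite compBr compA es compm1 subrr.
by rewrite -(compm1 t) -ks compA tk comp0m.
Qed.

(** A substitute for choosing preimages of elements: the hypothesis puts [x] into the image of [f],
    and [x] lifts after pullback to an epic cover. *)
Lemma cover_factor A B (f : hom A B) X (x : hom X B) :
  (forall T (t : hom B T), t \oc f = 0 -> t \oc x = 0) ->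
  exists V (v : hom V X) (s : hom V A), epi0 v /\ f \oc s = x \oc v.
Proof.
move=> h; have [Y [m [e [mm ee me]]]] := image_exists f.
have [|x' ex] := @mono_factor _ _ m _ x mm.
  by move=> Z z zm; apply: h; rewrite -me compA zm comp0m.
have [V [s [v [e1 ev _ _]]]] := pullback_epi x' ee.
by exists V, v, s; split=> //; rewrite -me -compA e1 compA ex.
Qed.

(** The cokernels of [x] and [y] are not jointly monic, so some nonzero [c] lies in both images; two
    successive covers make it a common restriction. *)
Lemma uniform_meet X A B (x : hom A X) (y : hom B X) : uniform_obj X ->
  x <> 0 -> y <> 0 ->
  exists V (s : hom V A) (t : hom V B), x \oc s = y \oc t /\ x \oc s <> 0.
Proof.
move=> uX nx ny.
have [C [p [px _ hp]]] := cokernel_exists x.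
have [D [q [qy _ hq]]] := cokernel_exists y.
have [V [c [nc pc qc]]] : exists V (c : hom V X), [/\ c <> 0, p \oc c = 0 &
    q \oc c = 0].
  apply: contrapT => h.
  have [T t pt qt|/(_ _ x px) //|/(_ _ y qy) //] := uX _ _ p q.
  by apply: contrapT => nt; apply: h; exists T, t.
have [|V1 [v1 [s [ev1 e1]]]] := @cover_factor _ _ x _ c.
  by move=> T t /hp [u <-]; rewrite -compA pc compm0.
have [|V2 [v2 [t [ev2 e2]]]] := @cover_factor _ _ y _ (c \oc v1).
  by move=> T t /hq [u <-]; rewrite compA -(compA u) qc compm0 comp0m.
exists V2, (s \oc v2), t; rewrite compA e1 e2; split=> // h.
by apply: nc; apply: ev1; apply: ev2.
Qed.

Lemma local_quotient X Y (q : hom X Y) : epi0 q -> local_obj X -> local_obj Y.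
Proof.
move=> eq lX A B f g fg.
have [P1 [q1 [p1 [e1 ep1 _ u1]]]] := pullback_epi f eq.
have [P2 [q2 [p2 [e2 ep2 _ u2]]]] := pullback_epi g eq.
have [T t h1 h2||] := lX _ _ q1 q2.
- have [|s es] := @epi_factor _ _ q _ t eq.
    move=> Z x qx; have [|u [<- _]] := u1 _ x 0; first by rewrite qx compm0.
    by rewrite compA h1 comp0m.
  rewrite -es (fg _ s) ?comp0m //.
    by apply: ep1; rewrite -compA -e1 compA es.
  by apply: ep2; rewrite -compA -e2 compA es.
- move=> h; left; apply: (epi0_of_comp (f := p1)); rewrite -e1.
  exact: epi0_comp.
- move=> h; right; apply: (epi0_of_comp (f := p2)); rewrite -e2.
  exact: epi0_comp.
Qed.

Hypothesis local_cover : forall A, exists n (L : 'I_n -> K)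
  (f : forall j, hom (L j) A), (forall j, local_obj (L j)) /\
  forall T (t : hom A T), (forall j, t \oc f j = 0) -> t = 0.

(** The preimage of C under [h] is covered by local objects, one of which already maps onto C; its
    image in X is D. *)
Lemma local_lift X C (h : hom X X) (i : hom C X) : local_obj C ->
  ~ is_zero C -> epi0 h -> mono0 i ->
  exists D (j : hom D X) (e : hom D C),
    [/\ local_obj D, mono0 j, epi0 e & h \oc j = i \oc e].
Proof.
move=> lC nC eh mi.
have [Y [q [p [e1 ep /(_ mi) mq _]]]] := pullback_epi i eh.
have [n [L [f [lL hf]]]] := local_cover Y.
have [j hj] : exists j, epi0 (p \oc f j).
  apply: (local_family (f := fun j => p \oc f j)) lC nC _ => T t ht.
  by apply: ep; apply: hf => k; rewrite -compA ht.
have [D [m [e [mm ee me]]]] := image_exists (q \oc f j).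
have [|d ed] := @mono_factor _ _ i _ (h \oc m) mi.
  move=> T t ti; rewrite compA; apply: ee.
  by rewrite -compA me -compA (compA h) e1 !compA ti !comp0m.
exists D, m, d; split=> //; first exact: (local_quotient ee (lL j)).
apply: (epi0_of_comp (f := e)).
suff -> : d \oc e = p \oc f j by [].
apply/eqP; rewrite -subr_eq0; apply/eqP/mi.
by rewrite compBr compA ed -compA me (compA i) -e1 compA subrr.
Qed.

End AbelianCategory.

(** * Powers of an endomorphism and essential kernels *)

Section EndoPowers.
Variables (K : preaddCat) (X : K) (h : hom X X).

Fixpoint hpow n : hom X X := if n is m.+1 then hpow m \oc h else idm X.

Lemma hpowD m n : hpow (m + n) = hpow m \oc hpow n.
Proof.
by elim: n => [|n IHn]; rewrite ?addn0 /= ?compm1 // addnS /= IHn compA.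
Qed.

Lemma hpowS n : hpow n.+1 = h \oc hpow n.
Proof. by rewrite -add1n hpowD /= comp1m. Qed.

Lemma hpow_epi n : epi0 h -> epi0 (hpow n).
Proof.
move=> eh; elim: n => [|n IHn] /=; last exact: epi0_comp.
by move=> T t; rewrite compm1.
Qed.

Lemma hpow_kill m n T (x : hom T X) : (m <= n)%N ->
  hpow m \oc x = 0 -> hpow n \oc x = 0.
Proof. by move=> /subnK <- e; rewrite hpowD -compA e compm0. Qed.

Definition ess_ker : Prop := forall T (x : hom T X), x <> 0 ->
  exists V (s : hom V T), x \oc s <> 0 /\ h \oc (x \oc s) = 0.

(** The kernel of [h] is essential in the union of the kernels of all its powers, whereas [ess_ker]
    makes it essential in X. *)
Definition ess_nil : Prop := forall n T (x : hom T X), x <> 0 ->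
  hpow n \oc x = 0 ->
  exists V (s : hom V T), x \oc s <> 0 /\ h \oc (x \oc s) = 0.

End EndoPowers.

Lemma hpow_hpow (K : preaddCat) (X : K) (h : hom X X) m n :
  hpow (hpow h m) n = hpow h (n * m).
Proof. by elim: n => [|n IHn] //=; rewrite IHn -hpowD mulSn addnC. Qed.

(** * Epic endomorphisms of local objects under left local finiteness *)

Section LocallyFiniteAbelian.
Variable K : addCat.
Implicit Types A B C D T V X Y Z : K.
Hypothesis hab : abelian K.
Hypothesis llf : left_locally_finite K.
Hypothesis indec_local : forall X, indecomposable X -> local_End X.
Hypothesis local_cover : forall A, exists n (L : 'I_n -> K)
  (f : forall j, hom (L j) A), (forall j, local_obj (L j)) /\
  forall T (t : hom A T), (forall j, t \oc f j = 0) -> t = 0.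
Hypothesis uniform_cocover : forall A, exists n (L : 'I_n -> K)
  (f : forall j, hom A (L j)), (forall j, uniform_obj (L j)) /\
  forall T (t : hom T A), (forall j, f j \oc t = 0) -> t = 0.

Lemma not_zero_mono A B (f : hom A B) : ~ is_zero A -> mono0 f -> f <> 0.
Proof.
move=> nA mf e; apply: nA; apply/is_zeroP; apply: mf; rewrite e; exact: comp0m.
Qed.

Lemma not_zero_epi A B (f : hom A B) : ~ is_zero B -> epi0 f -> f <> 0.
Proof.
move=> nA mf e; apply: nA; apply/is_zeroP; apply: mf; rewrite e; exact: compm0.
Qed.

Lemma not_zero_src A B (f : hom A B) : f <> 0 -> ~ is_zero A.
Proof. by move=> nf [_ h]; apply: nf; apply: h. Qed.

Lemma pigeonhole Y (X : nat -> K) : indecomposable Y ->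
  (forall n, indecomposable (X n)) ->
  (forall n, exists f : hom (X n) Y, f <> 0) ->
  exists m d, isomorphic (X m) (X (m + d.+1)%N).
Proof.
move=> /llf [N [L hL]] iX nX.
have /choice [k hk] : forall n, exists k, isomorphic (X n) (L k).
  by move=> n; apply: hL.
have /injectivePn [a [b nab eab]] :
    ~~ injectiveb [ffun i : 'I_N.+1 => k i].
  apply/negP => /injectiveP inj; have := leq_card _ inj.
  by rewrite !card_ord ltnn.
rewrite !ffunE in eab.
wlog ab : a b nab eab / (a < b)%N.
  move=> wl; case: (ltngtP a b) => [|/wl|/val_inj e]; first exact: wl.
    by apply=> //; rewrite eq_sym.
  by rewrite e eqxx in nab.
exists a, (b - a.+1)%N; rewrite addnS -addSn subnKC //.
by apply: isomorphic_trans (hk a) _; rewrite eab; apply: isomorphic_sym.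
Qed.

(* An object embedding in finitely many uniform ones has finite uniform
   dimension: the increasing chain of the kernels of the powers of [g] is
   eventually essential.  The induction on the number of uniform objects
   restricts to the elements satisfying [S]. *)
Lemma ess_stable X (g : hom X X) n (L : 'I_n -> K) (q : forall j, hom X (L j))
    (S : forall T, hom T X -> Prop) :
  (forall j, uniform_obj (L j)) ->
  (forall T (x : hom T X) V (s : hom V T), S T x -> S V (x \oc s)) ->
  (forall T (x y : hom T X), S T x -> S T y -> S T (x - y)) ->
  (forall T (x : hom T X), S T x -> (forall j, q j \oc x = 0) -> x = 0) ->
  exists n0, forall N T (x : hom T X), S T x -> x <> 0 ->
    hpow g N \oc x = 0 ->
    exists V (s : hom V T), x \oc s <> 0 /\ hpow g n0 \oc (x \oc s) = 0.
Proof.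
elim: n L q S => [|n IHn] L q S uL Sr SB Sq.
  by exists 0%N => N T x Sx nx _; case: nx; apply: Sq => // -[].
pose q0 := q ord0.
have [|||T x [Sx e] hx|n1 h1] := IHn (fun j => L (lift ord0 j))
    (fun j => q (lift ord0 j)) (fun T x => S T x /\ q0 \oc x = 0).
- by move=> j; apply: uL.
- by move=> T x V s [/Sr h e]; split=> //; rewrite compA e comp0m.
- move=> T x y [Sx ex] [Sy ey]; split; first exact: SB.
  by rewrite compBr ex ey subrr.
- apply: Sq => // j; case: (unliftP ord0 j) => [k ->|->]; [exact: hx|exact: e].
have [|ng] := pselect (forall N T (x : hom T X), S T x -> x <> 0 ->
    hpow g N \oc x = 0 ->
    exists V (s : hom V T), x \oc s <> 0 /\ hpow g n1 \oc (x \oc s) = 0).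
  by exists n1.
(* If [n1] fails, some [x2] killed by a power of [g] meets the kernel of [hpow g n1] trivially; by
   [h1], the map [q0] is then injective on [x2]. *)
have [n2 [T2 [x2 [Sx2 nx2 kx2 hx2]]]] : exists N T (x : hom T X),
    [/\ S T x, x <> 0, hpow g N \oc x = 0 &
     forall V (s : hom V T), x \oc s <> 0 -> hpow g n1 \oc (x \oc s) <> 0].
  apply: contrapT => nh; apply: ng => N T x Sx nx kx.
  apply: contrapT => nh2; apply: nh; exists N, T, x; split=> // V s n3 e.
  by apply: nh2; exists V, s.
have inj2 V (s : hom V T2) : q0 \oc (x2 \oc s) = 0 -> x2 \oc s = 0.
  move=> e; apply: contrapT => ns.
  have [||V' [s' [ns' es']]] := h1 n2 V (x2 \oc s) _ ns.
  - by split=> //; apply: Sr.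
  - by rewrite compA kx2 comp0m.
  by rewrite -!(compA x2) in ns' es'; exact: (hx2 _ _ ns' es').
exists (maxn n1 n2) => N T y Sy ny ky.
have [[V [s [ns es]]]|nys] := pselect (exists V (s : hom V T),
    y \oc s <> 0 /\ q0 \oc (y \oc s) = 0).
  have [||V' [s' [ns' es']]] := h1 N V (y \oc s) _ ns.
  - by split=> //; apply: Sr.
  - by rewrite compA ky comp0m.
  exists V', (s \oc s'); rewrite compA; split=> //.
  exact: hpow_kill (leq_maxl _ _) es'.
have nq0y : q0 \oc y <> 0.
  by move=> e; apply: nys; exists T, (idm T); rewrite !compm1.
have nq0x : q0 \oc x2 <> 0.
  by move=> e; apply: nx2; rewrite -(compm1 x2); apply: inj2; rewrite compm1.
have [V [s [t [est nst]]]] := uniform_meet hab (uL ord0) nq0y nq0x.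
(* [q0] agrees on [y s] and [x2 t], so it kills [z] and [h1] applies to [z]. The choice of [x2]
   prevents [y s w] from vanishing. *)
pose z := y \oc s - x2 \oc t.
have nys0 : y \oc s <> 0 by move=> e; apply: nst; rewrite -compA e compm0.
have [z0|nz] := pselect (z = 0).
  exists V, s; split=> //; move/eqP: z0; rewrite subr_eq0 => /eqP ->.
  by apply: (hpow_kill (leq_maxr _ _)); rewrite compA kx2 comp0m.
have [||W [w [nw ew]]] := h1 (maxn N n2) V z _ nz.
- split; first by apply: SB; apply: Sr.
  by rewrite compBr !compA est subrr.
- rewrite compBr !compA (hpow_kill (leq_maxl _ _) ky).
  by rewrite (hpow_kill (leq_maxr _ _) kx2) !comp0m subrr.
have eyw : y \oc s \oc w = x2 \oc (t \oc w) + z \oc w.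
  by rewrite compBl compA addrC subrK.
exists W, (s \oc w); rewrite compA; split.
  rewrite eyw => /eqP; rewrite addr_eq0 => /eqP e.
  apply: (hx2 _ (t \oc w)); rewrite e.
    by move=> /eqP; rewrite oppr_eq0 => /eqP.
  by rewrite compNr ew oppr0.
rewrite eyw compDr (hpow_kill (leq_maxl _ _) ew) addr0.
by apply: (hpow_kill (leq_maxr _ _)); rewrite compA kx2 comp0m.
Qed.

(* Starting from a local subobject of the kernel of [h], lift along [h] to local
   subobjects C_n of X with epimorphisms C_(n+1) -> C_n induced by [h]; by local
   finiteness some C_m is isomorphic to a later C_n. *)
Lemma local_tower X (h : hom X X) :
  local_obj X -> ~ is_zero X -> epi0 h -> ~ mono0 h -> ess_nil h ->
  exists C (j : hom C X) (h' : hom C C),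
    [/\ local_obj C /\ ~ is_zero C, epi0 h', ess_ker h', mono0 j & ~ epi0 j].
Proof.
move=> lX nX eh nmh essh.
pose Good (s : {D : K & hom D X}) := [/\ local_obj (projT1 s),
  ~ is_zero (projT1 s), mono0 (projT2 s) &
  exists n, hpow h n \oc projT2 s = 0].
have [s0 g0] : exists s, Good s.
  have [Y [k [hk mk uk]]] := kernel_exists hab h.
  have [n [L [f [lL hf]]]] := local_cover Y.
  have [j nj] : exists j, k \oc f j <> 0.
    apply: contrapT => nh; apply: nmh => T x /uk [u <-].
    rewrite (hf _ k) ?comp0m // => j; apply: contrapT => nj.
    by apply: nh; exists j.
  have [D [m [e [mm ee me]]]] := image_exists hab (k \oc f j).
  exists (existT _ D m); split=> //=.
  - exact: (local_quotient hab ee (lL j)).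
  - by apply: not_zero_src (m) _ => m0; apply: nj; rewrite -me m0 comp0m.
  - exists 1%N; rewrite /= comp1m; apply: ee.
    by rewrite -compA me compA hk comp0m.
pose S := {s | Good s}; pose ob (s : S) := projT1 (sval s).
pose mor (s : S) : hom (ob s) X := projT2 (sval s).
have step (s : S) : exists s' : S, exists e : hom (ob s') (ob s),
    epi0 e /\ h \oc mor s' = mor s \oc e.
  case: s => [[D i] [/= lD nD mi [n kn]]].
  have [D' [j [e [lD' mj ee hj]]]] := local_lift hab local_cover lD nD eh mi.
  have gD' : Good (existT _ D' j).
    split=> //=.
      by apply: not_zero_src (e) _; apply: not_zero_epi.
    by exists n.+1; rewrite /= -compA hj compA kn comp0m.
  by exists (exist _ _ gD'), e.
have [f [_ hf]] := dependent_sequence (exist _ s0 g0) step.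
have gf n : Good (sval (f n)) := svalP (f n).
have [m [d [th [th' [th1 th2]]]]] : exists m d,
    isomorphic (ob (f m)) (ob (f (m + d.+1)%N)).
  apply: (@pigeonhole X); first exact: local_indecomposable.
    by move=> n; have [? ? _ _] := gf n; apply: local_indecomposable.
  move=> n; have [_ hn hm _] := gf n; exists (mor (f n)).
  exact: not_zero_mono hm.
(* The composite of the steps from the later object to [ob (f m)]. It kills whatever [h] kills, so
   the essentiality in [essh] passes to [e]. *)
have [e [ee he]] : exists e : hom (ob (f (m + d.+1)%N)) (ob (f m)), epi0 e /\
    forall T (x : hom T _), h \oc (mor (f (m + d.+1)%N) \oc x) = 0 ->
      e \oc x = 0.
  move: {th th' th1 th2} d; elim=> [|d [e [ee _]]].
    rewrite addn1; have [e [ee he]] := hf m; exists e; split=> // T x hx.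
    have [_ _ mm _] := gf m; apply: mm.
    by rewrite compA -he -compA.
  rewrite addnS; have [e' [ee' he']] := hf (m + d.+1)%N.
  exists (e \oc e'); split=> [|T x hx]; first exact: epi0_comp.
  have [_ _ mm _] := gf (m + d.+1)%N.
  rewrite -compA (mm _ (e' \oc x)) ?compm0 //.
  by rewrite compA -he' -compA.
have [lC nC mm [n kn]] := gf m.
have [_ _ mm' [n' kn']] := gf (m + d.+1)%N.
have ith : is_iso th by exists th'.
exists (ob (f m)), (mor (f m)), (e \oc th); split=> //.
- by apply: epi0_comp => //; apply: iso_epi0.
- move=> T x nx; have [||V [s [ns es]]] := essh n' _ (mor _ \oc (th \oc x)).
  + by move=> /mm' /(iso_mono0 ith).
  + by rewrite compA kn' comp0m.
  exists V, s; split; first by move=> e0; apply: ns; rewrite -!compA e0 !compm0.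
  by rewrite -compA; apply: he; rewrite -!compA in es *.
(* A power of [h] kills the subobject. Were its inclusion epic, this power would be zero as well as
   epic, and X would be zero. *)
- move=> em; have h0 : hpow h n = 0 by apply: em.
  apply: nX; apply/is_zeroP; apply: (hpow_epi (n := n) eh).
  by rewrite comp1m.
Qed.

(* Iterating [local_tower] yields, on one local object, a monic non-epic [u] and
   an epic [k] with essential kernel; then u + k is invertible, which is
   impossible in a local endomorphism ring. *)
Lemma no_essential_epi X (h : hom X X) :
  local_obj X -> ~ is_zero X -> epi0 h -> ess_ker h -> False.
Proof.
move=> lX nX eh ek.
pose Good (s : {D : K & hom D D}) := [/\ local_obj (projT1 s),
  ~ is_zero (projT1 s), epi0 (projT2 s) & ess_ker (projT2 s)].
have g0 : Good (existT _ X h) by [].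
pose S := {s | Good s}; pose ob (s : S) := projT1 (sval s).
have nonmono D (k : hom D D) : ~ is_zero D -> ess_ker k -> ~ mono0 k.
  move=> nD ekk mk; have [|V [s [ns es]]] := ekk _ (idm D).
    by move=> /is_zeroP.
  by apply: ns; apply: mk.
have step (s : S) : exists s' : S, exists j : hom (ob s') (ob s),
    mono0 j /\ ~ epi0 j.
  case: s => [[D i] [/= lD nD ei eki]].
  have [|C [j [h' [[lC nC] eh' ek' mj nj]]]] :=
      local_tower lD nD ei (nonmono _ _ nD eki).
    by move=> n T x nx _; apply: eki.
  have gC : Good (existT _ C h') by [].
  by exists (exist _ _ gC), j.
have [f [_ hf]] := dependent_sequence (exist _ _ g0) step.
have gf n : Good (sval (f n)) := svalP (f n).
have chain m d : exists j : hom (ob (f (m + d.+1)%N)) (ob (f m)),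
    mono0 j /\ ~ epi0 j.
  elim: d => [|d [j [mj nj]]]; first by rewrite addn1; apply: hf.
  rewrite addnS; have [j' [mj' _]] := hf (m + d.+1)%N.
  by exists (j \oc j'); split; [apply: mono0_comp | move=> /epi0_of_comp].
have [m [d [th ith]]] : exists m d,
    isomorphic (ob (f m)) (ob (f (m + d.+1)%N)).
  apply: (@pigeonhole (ob (f 0%N))).
  - by have [? ? _ _] := gf 0%N; apply: local_indecomposable.
  - by move=> n; have [? ? _ _] := gf n; apply: local_indecomposable.
  move=> [|n].
    exists (idm _) => /= e; have [_ n0 _ _] := gf 0%N.
    by apply: n0; apply/is_zeroP.
  have [j [mj _]] := chain 0%N n; have [_ hn _ _] := gf (0 + n.+1)%N.
  by exists j; apply: not_zero_mono mj.
have [j [mj nj]] := chain m d; have [lC nC ek' essk] := gf m.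
set k := projT2 _ in ek' essk; set C := projT1 _ in lC nC k ek' essk.
pose u : hom C C := j \oc th.
have nu : ~ epi0 u by move=> /epi0_of_comp.
have mu : mono0 u by apply: mono0_comp => //; apply: iso_mono0.
have [|_ +] := indec_local (X := C); first exact: local_indecomposable.
(* On the essential kernel of [k] the sum is the monic [u], so it is monic. Since [k = (u + k) - u]
   is epic and [u] is not, locality of C makes [u + k] epic. *)
have iuk : is_iso (u + k).
  apply: (mono_epi_iso hab).
    move=> T t et; apply: contrapT => /essk [V [s [ns es]]].
    apply: ns; apply: mu; have := congr1 (fun v => v \oc s) et.
    by rewrite compDl compDl -!compA es comp0m addr0.
  have [T t e1 e2|//|//] := lC _ _ (u + k) u.
  by apply: ek'; move: e1; rewrite compDr e2 add0r.
by move=> /(_ _ _ iuk) [/iso_epi0|/iso_mono0 /(nonmono _ _ nC essk)].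
Qed.

(** If [g] is not monic, [ess_stable] yields a power of [g] satisfying [ess_nil], and [local_tower]
    turns it into a local object contradicting [no_essential_epi]. *)
Lemma no_local_epi X (g : hom X X) :
  local_obj X -> ~ is_zero X -> epi0 g -> mono0 g.
Proof.
move=> lX nX eg; apply: contrapT => nm.
have [n [L [q [uL hq]]]] := uniform_cocover X.
have [|||n0 h0] := @ess_stable X g n L q (fun _ _ => True) uL; try by [].
  by move=> T x _; apply: hq.
(* The exponent is positive so that [h] ends in a factor [g] and inherits its failure to be
   monic. *)
pose h := hpow g n0.+1.
have nh : ~ mono0 h by move=> /mono0_of_comp.
have essh : ess_nil h.
  move=> N T x nx; rewrite hpow_hpow => /(h0 _ _ _ I nx) [V [s [ns es]]].
  by exists V, s; rewrite /h hpowS -compA es compm0.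
have [C [j [h' [[lC nC] eh' ek' _ _]]]] :=
  local_tower lX nX (hpow_epi (n := n0.+1) eg) nh essh.
exact: no_essential_epi lC nC eh' ek'.
Qed.

End LocallyFiniteAbelian.

(** * Generating classes *)

Section LocalModulo.
Variables (K : preaddCat) (W : K -> Prop).
Implicit Types A B T X : K.

Definition mlocal X : Prop :=
  forall A B (f : hom A X) (g : hom B X),
  (forall T (t : hom X T), factors_through W (t \oc f) ->
     factors_through W (t \oc g) -> factors_through W t) ->
  mepi W f \/ mepi W g.

Definition muniform X : Prop :=
  forall A B (f : hom X A) (g : hom X B),
  (forall T (t : hom T X), factors_through W (f \oc t) ->
     factors_through W (g \oc t) -> factors_through W t) ->
  mmono W f \/ mmono W g.

End LocalModulo.

Lemma op_mlocal (K : preaddCat) (W : K -> Prop) (X : K) :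
  @mlocal (op_preadd K) W X -> muniform W X.
Proof.
move=> h A B f g hfg.
have [|/op_mepi|/op_mepi] := h A B f g; [|by left|by right].
by move=> T t /op_factors h1 /op_factors h2; apply/op_factors; apply: hfg.
Qed.

Section GeneratingClasses.
Variables (E : extriCat) (W : E -> Prop).
Hypotheses (KS : krull_schmidt E) (hW : hereditary_like W).
Implicit Types A B C P T U V X Y Z : E.
Notation nul := (factors_through W).
Let hA := hereditary_like_additive hW.

(* In the quotient, the source [A] of a generating class has no proper
   subobject from which the class is induced. *)
Definition generating U A (d : Ext (ext E) U A) : Prop :=
  wclass W d /\
  exists (B : E) (a : hom A B) (b : hom B U), realizes d a b /\ W B.

Lemma generating_nul U A (d : Ext (ext E) U A) T (t : hom A T) :
  generating d -> push t d = 0 -> nul t.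
Proof.
move=> [_ [B [a [b [r WB]]]]] /(realizes_extend t r) [g <-].
by exists B; split=> //; exists g, a.
Qed.

(** A class killed by [pull b] is the pushout of [e] along some map P -> V, and [e] dies in every
    object of [W]. *)
Lemma wclass_pull0_inj P B U (e : Ext (ext E) U P) (a : hom P B) (b : hom B U)
    V (z : Ext (ext E) U V) :
  realizes e a b -> wclass W e -> W V -> pull b z = 0 -> z = 0.
Proof.
move=> r we WV /=; have [Y [x [y [r' _]]]] := realizes_class z.
move=> /(realizes_lift b r') [b' eb].
have [|c [ec _]] := @realizes_ET3op E _ _ _ _ _ _ _ _ _ _ _ _ b' (idm U) r r'.
  by rewrite comp1m.
by rewrite -(pull1 z) -ec we.
Qed.

(** With [p], [q] the cokernels of [f], [g], the class (p e, 0) is the pullback of (p e, q e) along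
    an endomorphism [c] of U. As U is local, [c] or [1 - c] is invertible, so [q e] or [p e]
    vanishes and the corresponding cokernel is null. *)
Lemma generating_local U P (e : Ext (ext E) U P) :
  local_End U -> W U -> generating e -> mlocal W P.
Proof.
move=> lU WU ge A1 A2 f g hfg.
have [Q1 [p [[pf hp] ep]]] := mod_coker hW f.
have [Q2 [q [[qg hq] eq]]] := mod_coker hW g.
have [S] := has_biprod Q1 Q2.
pose pq := bp_inl S \oc p + bp_inr S \oc q.
have epq : mepi W pq.
  move=> T t ht.
  have h1 : nul (t \oc bp_inl S \oc p).
    apply: hfg; rewrite -!compA.
      by apply: nul_compl; apply: nul_compl.
    have := nul_compr g ht.
    rewrite -!compA compDl compDr -!compA addrC => h.
    rewrite -(addKr (t \oc (bp_inr S \oc (q \oc g))) (t \oc _)).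
    apply: (nulD hA); last exact: h.
    by apply: (nulN hA); apply: nul_compl; apply: nul_compl.
  have h2 : nul (t \oc bp_inr S \oc q).
    rewrite -(addKr (t \oc bp_inl S \oc p) (t \oc bp_inr S \oc q)).
    by apply: (nulD hA); [apply: (nulN hA)|rewrite -!compA -compDr].
  rewrite -(compm1 t) -(bp_id S) compDr !compA; apply: (nulD hA).
    by apply: nul_compr; apply: ep.
  by apply: nul_compr; apply: eq.
have [D [x [y [r _]]]] := realizes_class (push pq e).
have [we [B [a [b [re WB]]]]] := ge.
have wpq : wclass W (push pq e) by apply: wclass_push.
(* The map [x] is null because [x pq] factors through B and [pq] is epic modulo [W]; so the identity
   of D factors modulo [W] through U. *)
have WD : W D.
  have nx : nul x.
    apply: epq; have [|d [ed _]] := @realizes_map E _ _ _ _ _ _ _ _ _ _ _ _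
      pq (idm U) re r; first by rewrite pull1.
    by rewrite -ed; exists B; split=> //; exists d, a.
  apply: (nul_id_closed KS (hl_sums hW) (hl_summands hW)).
  have mx := (wclass_monic W r).1 wpq.
  have [_ hy] := triangle_wcoker hW r mx.
  have [|u hu] := hy _ (idm D); first by rewrite comp1m.
  by apply: (nul_cancel hA hu); apply: nul_compl; apply: nul_tgt.
pose z := push (bp_inl S) (push p e).
have [c ec] : exists c, z = pull c (push pq e).
  apply: (realizes_push0 r).
  exact: (wclass_push (bp_inl S) (wclass_push p we)) WD x.
have e1 : push p e = pull c (push p e).
  have := congr1 (push (bp_prl S)) ec; rewrite push_pull -!push_comp.
  by rewrite /pq bp_pair_prl bp_ll comp1m.
have e2 : pull c (push q e) = 0.
  have := congr1 (push (bp_prr S)) ec; rewrite push_pull -!push_comp.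
  rewrite /pq bp_pair_prr bp_rl comp0m => <-.
  exact: push_zero.
have mep A T' (k : hom A P) (c' : hom P T') :
    (forall T (h : hom P T), nul (h \oc k) -> exists u : hom T' T,
       nul (h - u \oc c')) -> push c' e = 0 -> mepi W k.
  move=> hc' ec' T t /hc' [u hu]; apply: (nul_cancel hA hu).
  by apply: nul_compl; apply: generating_nul ec'.
have [[c' [_ cc']]|[c' [_ cc']]] := local_iso lU c.
  right; apply: (mep _ _ g q hq).
  by rewrite -(pull1 (push q e)) -cc' pull_comp e2 pull0.
left; apply: (mep _ _ f p hp).
by rewrite -(pull1 (push p e)) -cc' pull_comp pull_idB // pull0.
Qed.

Hypothesis (nm : normal_monos W) (ne : normal_epis W).

(** Normality makes [f] a cokernel of [k] in E/W. In the pushout along [t], the map [c] kills [k]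
    modulo [W], hence factors through [f] and gives a section of [d] modulo [W]. *)
Lemma epic_wclass K A B (s : Ext (ext E) B K) (k : hom K A) (f : hom A B) :
  realizes s k f -> Wepic W f -> mepi W f -> wclass W s.
Proof.
move=> r ef mf V WV t.
have [C [j [d [rC _]]]] := realizes_class (push t s).
have [|c [cj dc]] := @realizes_map E _ _ _ _ _ _ _ _ _ _ _ _ t (idm B) r rC.
  by rewrite pull1.
rewrite comp1m in dc.
have [|u hu] := ne mf (triangle_wker hW r ef) (x := c).
  by rewrite cj; apply: nul_compl; apply: nul_tgt.
(* The null error of the section is lifted through the W-epic [f]; adding [c w] to [u] corrects it
   to an honest section. *)
have [|w [ew _]] := epic_nul ef (f := idm B - d \oc u).
  apply: mf; rewrite compBl comp1m -{1}dc -compA -compBr.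
  exact: nul_compl.
rewrite -(pull1 (push t s)).
apply/(realizes_lift _ rC); exists (u + c \oc w).
by rewrite compDr compA dc ew addrC subrK.
Qed.

(** K is the kernel of [a] in E/W, realized by a triangle K -> W1 + A -> B. Modulo [W] the map [a]
    is epic, its cone being in [W], so [epic_wclass] makes [k] W-monic; hence the lift of [d] to K
    is again a [wclass]. *)
Lemma wclass_kernel U A B (d : Ext (ext E) U A) (a : hom A B) (b : hom B U) :
  realizes d a b -> W U -> wclass W d ->
  exists (K : E) (k : hom K A) (e : Ext (ext E) U K),
    [/\ wclass W e, push k e = d, mmono W k & nul (a \oc k)].
Proof.
move=> r WU wd.
have [W2 [W1 [i [w [[s rs] WW1 WW2 [_ ew]]]]]] := hl_right hW B.
have [S] := has_biprod W1 A.
have [K [k [s' r']]] := deflation_pair a S rs.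
set f := _ + _ in r'.
have ef : Wepic W f.
  move=> V WV t; have [t' <-] := ew V WV t.
  by exists (bp_inl S \oc t'); rewrite compA bp_copair_inl.
have ma : mepi W a.
  move=> T t ta; have [_ hb] := triangle_wcoker hW r ((wclass_monic W r).1 wd).
  have [u hu] := hb _ _ ta; apply: (nul_cancel hA hu).
  by apply: nul_compl; apply: nul_tgt.
have mf : mepi W f.
  move=> T t /(nul_compr (bp_inr S)).
  by rewrite -compA bp_copair_inr => /ma.
have ws := epic_wclass r' ef mf.
have mk := triangle_mmono hW r' ef.
have fk0 := realizes_comp0 r'.
have [|e ee] := @realizes_push0_mid _ _ _ _ _ _ _ _ (push (bp_inr S) d) r'.
  by rewrite -push_comp bp_copair_inr (realizes_push_l r).
exists K, (bp_prr S \oc k), e; split.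
- move=> V WV t; have [t' <-] := (wclass_monic W r').1 ws V WV t.
  by rewrite push_comp ee -push_comp wd.
- by rewrite push_comp ee -push_comp bp_rr push1.
- move=> T t ht; apply: mk; rewrite (bp_in_dec (k \oc t)).
  apply: (nulD hA); apply: nul_compl; first exact: nul_tgt.
  by rewrite compA.
- move: fk0; rewrite /f compDl -!compA => /eqP.
  rewrite addrC addr_eq0 => /eqP ->; apply: (nulN hA).
  by apply: nul_compl; apply: nul_tgt.
Qed.

(* A cokernel of K2 -> K -> A kills the class [d], hence factors through B and
   kills K; so the class of K cannot be carried by the kernel K2 of K -> L
   unless K -> L vanishes modulo [W]. *)
Lemma generating_exists U A (d : Ext (ext E) U A) : W U -> wclass W d ->
  exists (K : E) (k : hom K A) (e : Ext (ext E) U K),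
    generating e /\ push k e = d.
Proof.
move=> WU wd; have [B [a [b [r _]]]] := realizes_class d.
have [K [k [e [we ke mk ak]]]] := wclass_kernel r WU wd.
exists K, k, e; split=> //; split=> //.
have [L [l [u [re _]]]] := realizes_class e.
exists L, l, u; split=> //.
have [K2 [k2 [e2 [we2 ke2 mk2 lk2]]]] := wclass_kernel re WU we.
have [T [t [[tk ht] mt]]] := mod_coker hW (k \oc k2).
have [t' et] : exists t', t' \oc a = t.
  apply/(realizes_extend t r); rewrite -ke -ke2 -!push_comp -compA.
  exact: wclass_nul we2 tk.
have [|s hs] := @nm _ _ _ _ _ (mmono_comp mk mk2) (conj tk ht) _ k.
  by rewrite -et -compA; apply: nul_compl.
have h2 : nul (idm K - k2 \oc s).
  by apply: mk; rewrite compBr compm1 compA.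
have nl : nul l.
  rewrite -(compm1 l) -(subrK (k2 \oc s) (idm K)) compDr.
  apply: (nulD hA); first exact: nul_compl.
  by rewrite compA; apply: nul_compr.
have [_ hu] := triangle_wcoker hW re ((wclass_monic W re).1 we).
have [|v hv] := hu _ (idm L); first by rewrite comp1m.
apply: (nul_id_closed KS (hl_sums hW) (hl_summands hW)).
by apply: (nul_cancel hA hv); apply: nul_compl; apply: nul_tgt.
Qed.

(** Split W2 of a left approximation triangle A -> W1 -> W2 into local summands and restrict its
    class to each: the sources of generating classes inducing these restrictions cover A. *)
Lemma mlocal_cover A : exists n (L : 'I_n -> E) (f : forall j, hom (L j) A),
  (forall j, mlocal W (L j)) /\
  forall T (t : hom A T), (forall j, nul (t \oc f j)) -> nul t.
Proof.
have [W1 [W2 [w [p [[d r] WW1 WW2 [_ mw]]]]]] := hl_left hW A.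
have wd := (wclass_monic W r).2 mw.
have [n [U [lU hU]]] := KS W2; have [i [q [_ _ iq]]] := hU.
have WU j : W (U j).
  by apply: (hl_summands hW) WW2; apply: dsum_summand hU.
have h j : exists s : {K : E & hom K A},
    exists e : Ext (ext E) (U j) (projT1 s),
    generating e /\ push (projT2 s) e = pull (i j) d.
  have [K [k [e he]]] := generating_exists (WU j) (wclass_pull (i j) wd).
  by exists (existT _ K k), e.
have [s hs] := choice h.
exists n, (fun j => projT1 (s j)), (fun j => projT2 (s j)); split=> [j|T t ht].
  by have [e [ge _]] := hs j; apply: generating_local ge.
have td : push t d = 0.
  apply: (dsum_pull0 iq) => j; have [e [[we _] ee]] := hs j.
  by rewrite -push_pull -ee -push_comp (wclass_nul we (ht j)).
have [g <-] := (realizes_extend t r).1 td.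
by exists W1; split=> //; exists g, w.
Qed.

End GeneratingClasses.

Lemma muniform_cocover (E : extriCat) (W : E -> Prop) (A : E) :
  krull_schmidt E -> hereditary_like W -> normal_monos W -> normal_epis W ->
  exists n (L : 'I_n -> E) (f : forall j, hom A (L j)),
  (forall j, muniform W (L j)) /\
  forall T (t : hom T A), (forall j, factors_through W (f j \oc t)) ->
    factors_through W t.
Proof.
move=> KS hW nm ne.
have nm' : @normal_monos (op_extri E) W by apply/op_normal_monos.
have ne' : @normal_epis (op_extri E) W by apply/op_normal_epis.
have [n [L [f [hL hf]]]] := @mlocal_cover (op_extri E) W
  (op_krull_schmidt KS) (op_hereditary_like hW) nm' ne' A.
exists n, L, f; split=> [j|T t ht]; first exact: op_mlocal.
by apply/op_factors; apply: hf => j; apply/op_factors.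
Qed.

Lemma local_End_iso (K : preaddCat) (A B : K) :
  isomorphic A B -> local_End A -> local_End B.
Proof.
move=> [f [g [gf fg]]] [n1 h]; split=> [e|u v iuv].
  by apply: n1; rewrite -gf -(comp1m f) e comp0m compm0.
have i1 : is_iso f by exists g.
have i2 : is_iso g by exists f.
have back w : is_iso (g \oc w \oc f) -> is_iso w.
  move=> iw; have -> : w = f \oc (g \oc w \oc f) \oc g.
    by rewrite !compA fg comp1m -compA fg compm1.
  by apply: is_iso_comp => //; apply: is_iso_comp.
have [|/back|/back] := h (g \oc u \oc f) (g \oc v \oc f); [|by left|by right].
by rewrite -compDl -compDr; apply: is_iso_comp => //; apply: is_iso_comp.
Qed.

(** * The relative extriangulated structure *)

Section AbelianQuotientLocal.
Variables (E : extriCat) (W : E -> Prop).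
Hypotheses (KS : krull_schmidt E) (hW : hereditary_like W).
Let hA := hereditary_like_additive hW.
Notation nul := (factors_through W).
Notation Q := (ideal_quotient hA).
Notation pi f := (qpi hA f : @hom Q _ _).

Lemma quotient_is_zero (X : E) : is_zero (X : Q) <-> nul (idm X).
Proof. by split=> [/is_zeroP /qpi_nul|h]; last by apply/is_zeroP/qpi_nul. Qed.

(** Lift an inverse of [f + g] to [h]. Then [1 - h (f + g)] is null, hence not invertible since Y is
    nonzero in the quotient; so [h (f + g)] is invertible already in E. *)
Lemma quotient_local (Y : E) :
  local_End Y -> ~ is_zero (Y : Q) -> local_End (Y : Q).
Proof.
move=> lY nY; split=> [/is_zeroP //|f g].
have [{}f ->] := qpi_surj f; have [{}g ->] := qpi_surj g.
rewrite -qpiD => ifg; have [h0 [e1 e2]] := ifg; have [h eh] := qpi_surj h0.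
rewrite eh -qpiM in e1; rewrite eh -qpiM in e2.
have ih : is_iso (pi h) by exists (pi (f + g)); rewrite -!qpiM.
have n1 : nul (idm Y - h \oc (f + g)).
  by apply/(qpi_nul hA); rewrite qpi_sub qpi1 e1 subrr.
have ihfg : is_iso (h \oc (f + g)).
  have [iz|] := local_iso lY (idm Y - h \oc (f + g)); last first.
    by rewrite opprB addrC subrK.
  case: nY; apply/quotient_is_zero; have [k [k1 _]] := iz.
  by rewrite -k1; apply: nul_compl.
have back (w : hom Y Y) : is_iso (h \oc w) -> is_iso (pi w).
  move=> [k [k1 k2]]; have [h' [h1 h2]] := ih.
  have -> : pi w = h' \oc pi (h \oc w) by rewrite qpiM compA h1 comp1m.
  apply: is_iso_comp; first by exists (pi h).
  by exists (pi k); rewrite -!qpiM k1 k2.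
by move: ihfg; rewrite compDr => /lY.2 [] /back; [left|right].
Qed.

Lemma quotient_indecomposable_local (X : Q) :
  indecomposable X -> local_End X.
Proof.
move=> [nX iX]; have [n [Y [lY [i [p [p1 p2 ip]]]]]] := KS X.
have dX : @is_direct_sum Q n Y X.
  exists (fun k => pi (i k)), (fun k => pi (p k)); split.
  - by move=> k; rewrite -qpiM p1.
  - by move=> k l nkl; rewrite -qpiM p2 // qpi0.
  - rewrite -(qpi1 hA) -ip; elim/big_rec2: _ => [|k f g _ ->].
      by symmetry; apply: qpi0.
    by rewrite -qpiM -qpiD.
have [k nk] : exists k, ~ is_zero (Y k : Q).
  apply: contrapT => h; apply: nX; apply/is_zeroP.
  have [j [q [_ _ <-]]] := dX; apply: big1 => k _.
  have [h0 _] : is_zero (Y k : Q) by apply: contrapT => nk; apply: h; exists k.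
  by rewrite [q k]h0 compm0.
case: n Y lY i p p1 p2 ip dX k nk => [|n] Y lY i p p1 p2 ip dX k nk.
  by case: k {nk}.
have [R [S [_ eS]]] := dsum_split k dX.
have iS : isomorphic S X by rewrite eS; exists (idm X); apply: is_iso_id.
have [//|/is_zeroP zR] := iX _ _ S iS.
apply: local_End_iso (quotient_local (lY k) nk).
apply: isomorphic_trans iS; exists (bp_inl S), (bp_prl S).
split; first exact: bp_ll.
by rewrite -(bp_id S) -(comp1m (bp_prr S)) zR comp0m compm0 addr0.
Qed.

Lemma quotient_local_obj (X : E) : mlocal W X -> @local_obj Q X.
Proof.
move=> h A B f g fg; have [f' ef] := qpi_surj f; have [g' eg] := qpi_surj g.
rewrite ef eg in fg *.
have [|/(qpi_epi0 hA)|/(qpi_epi0 hA)] := h _ _ f' g'; [|by left|by right].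
move=> T t /(qpi_nul hA) h1 /(qpi_nul hA) h2; apply/(qpi_nul hA).
by apply: fg; rewrite -qpiM.
Qed.

Lemma quotient_uniform_obj (X : E) : muniform W X -> @uniform_obj Q X.
Proof.
move=> h A B f g fg; have [f' ef] := qpi_surj f; have [g' eg] := qpi_surj g.
rewrite ef eg in fg *.
have [|/(qpi_mono0 hA)|/(qpi_mono0 hA)] := h _ _ f' g'; [|by left|by right].
move=> T t /(qpi_nul hA) h1 /(qpi_nul hA) h2; apply/(qpi_nul hA).
by apply: fg; rewrite -qpiM.
Qed.

Hypothesis hab : abelian Q.

Let nm : normal_monos W := ((abelian_normal hW hA).1 hab).1.
Let ne : normal_epis W := ((abelian_normal hW hA).1 hab).2.

Lemma quotient_local_cover (A : Q) : exists n (L : 'I_n -> Q)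
  (f : forall j, hom (L j) A), (forall j, local_obj (L j)) /\
  forall T (t : hom A T), (forall j, t \oc f j = 0) -> t = 0.
Proof.
have [n [L [f [lL hf]]]] := mlocal_cover KS hW nm ne A.
exists n, L, (fun j => pi (f j)); split=> [j|T t].
  exact: quotient_local_obj.
have [{}t ->] := qpi_surj t => h; apply/qpi_nul; apply: hf => j.
by apply/(qpi_nul hA); rewrite qpiM.
Qed.

Lemma quotient_uniform_cocover (A : Q) : exists n (L : 'I_n -> Q)
  (f : forall j, hom A (L j)), (forall j, uniform_obj (L j)) /\
  forall T (t : hom T A), (forall j, f j \oc t = 0) -> t = 0.
Proof.
have [n [L [f [lL hf]]]] := muniform_cocover A KS hW nm ne.
exists n, L, (fun j => pi (f j)); split=> [j|T t].
  exact: quotient_uniform_obj.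
have [{}t ->] := qpi_surj t => h; apply/qpi_nul; apply: hf => j.
by apply/(qpi_nul hA); rewrite qpiM.
Qed.

Hypothesis llf : left_locally_finite Q.

(** Otherwise there is an infinite chain of epic, non-monic maps between nonzero local objects. Left
    local finiteness makes two of them isomorphic, giving an epic, non-monic endomorphism against
    [no_local_epi]. *)
Lemma terminal_generating (U A : E) (d : Ext (ext E) U A) :
  local_End U -> W U -> wclass W d -> d <> 0 ->
  exists (P : E) (e : Ext (ext E) U P), [/\ generating W e, e <> 0 &
    forall (P' : E) (e' : Ext (ext E) U P') (p : hom P' P),
    generating W e' -> push p e' = e -> mmono W p].
Proof.
move=> lU WU wd nd; apply: contrapT => none.
pose Good (s : {P : E & Ext (ext E) U P}) :=
  generating W (projT2 s) /\ projT2 s <> 0.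
have [s0 g0] : exists s, Good s.
  have [P [k [e [ge ke]]]] := generating_exists KS hW nm ne WU wd.
  exists (existT _ P e); split=> //= e0; apply: nd.
  by rewrite -ke e0 push0.
pose S := {s | Good s}; pose ob (s : S) : Q := projT1 (sval s).
have step (s : S) : exists s' : S, exists p : hom (ob s') (ob s),
    epi0 p /\ ~ mono0 p.
  case: s => [[P e] [/= ge ne0]].
  apply: contrapT => nh; apply: none; exists P, e; split=> // P' e' p ge' pe.
  apply: contrapT => np; apply: nh.
  have g' : Good (existT _ P' e').
    by split=> //= e0; apply: ne0; rewrite -pe e0 push0.
  exists (exist _ _ g'), (pi p); split; last by move=> /qpi_mono0.
  apply/qpi_epi0 => T t ht; apply: (generating_nul ge).
  by rewrite -pe -push_comp; apply: wclass_nul ht; case: ge'.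
have [f [_ hf]] := dependent_sequence (exist _ s0 g0) step.
have lf n : local_obj (ob (f n)).
  have [gn _] := svalP (f n); apply: quotient_local_obj.
  exact: (generating_local KS hW lU WU gn).
have nf n : ~ is_zero (ob (f n)).
  move=> /quotient_is_zero zn; have [[wn _] n0] := svalP (f n).
  by apply: n0; rewrite -(push1 (projT2 _)); apply: wclass_nul zn.
have chain m d' : exists p : hom (ob (f (m + d'.+1)%N)) (ob (f m)),
    epi0 p /\ ~ mono0 p.
  elim: d' => [|k [p [ep _]]]; first by rewrite addn1; apply: hf.
  rewrite addnS; have [p' [ep' np']] := hf (m + k.+1)%N.
  exists (p \oc p'); split; first exact: epi0_comp.
  by move=> /mono0_of_comp.
have [m [k [th ith]]] : exists m k,
    isomorphic (ob (f m)) (ob (f (m + k.+1)%N)).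
  apply: (pigeonhole llf (Y := ob (f 0%N))) => [|n|[|n]].
  - exact: local_indecomposable.
  - exact: local_indecomposable.
  - by exists (idm _) => /is_zeroP /nf.
  have [p [ep _]] := chain 0%N n.
  by exists p; apply: not_zero_epi ep.
have [p [ep np]] := chain m k.
have : mono0 (p \oc th).
  apply: (no_local_epi hab llf quotient_indecomposable_local
    quotient_local_cover quotient_uniform_cocover) => //.
  by apply: epi0_comp => //; apply: iso_epi0.
have [th' [e1 e2]] := ith => mp; apply: np => T t pt.
have /mp e3 : (p \oc th) \oc (th' \oc t) = 0.
  by rewrite -compA (compA th) e2 comp1m.
by rewrite -(comp1m t) -e2 -compA e3 compm0.
Qed.

(** * Vanishing of the relative extensions between objects of [W] *)

Notation killed z := (rel_pred (e_complement W) z).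

Lemma e_free_complement (U : E) : e_free W U -> e_complement W U.
Proof.
move=> fU; exists 1%N, (fun _ => U), U; split=> //; first exact: dsum1.
by apply: iso_summand; exists (idm U); apply: is_iso_id.
Qed.

(** If the class split, with section [s] of [b], then [1 - s b] would fix [a], hence be invertible
    by left minimality, although it kills [s]. *)
Lemma e_part_wclass (X : E) : e_part W X -> ~ is_zero X ->
  exists (A : E) (d : Ext (ext E) X A), wclass W d /\ d <> 0.
Proof.
move=> [WX [A [B [a [b [[d r] lm ma]]]]]] nX; exists A, d; split.
  exact/(wclass_monic W r).
move=> d0; apply: nX; apply/is_zeroP.
have [s bs] : exists s, b \oc s = idm X.
  by apply/(realizes_lift _ r); rewrite d0 pull0.
have [|g [g1 _]] := lm (idm B - s \oc b).
  by rewrite compBl comp1m -compA (realizes_comp0 r) compm0 subr0.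
have z : (idm B - s \oc b) \oc s = 0.
  by rewrite compBl comp1m -compA bs compm1 subrr.
by rewrite -bs -(comp1m s) -g1 -compA z !compm0.
Qed.

Lemma local_dichotomy (U : E) : W U -> e_free W U \/
  exists (A : E) (d : Ext (ext E) U A), wclass W d /\ d <> 0.
Proof.
move=> WU; have [|no] := pselect (exists (A : E) (d : Ext (ext E) U A),
  wclass W d /\ d <> 0); [by right|left].
split=> // X [Y [S [f [g [gf fg]]]]] eX; apply: contrapT => nX.
have [A [d [wd nd]]] := e_part_wclass eX nX; apply: no.
exists A, (pull (bp_prl S \oc g) d); split; first exact: wclass_pull.
move=> e0; apply: nd; have := congr1 (pull (f \oc bp_inl S)) e0.
rewrite -pull_comp pull0 -compA (compA g) gf comp1m bp_ll => <-.
by rewrite pull1.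
Qed.

Lemma nonsplit_radical (U P B : E) (e : Ext (ext E) U P) (a : hom P B)
    (b : hom B U) :
  local_End U -> realizes e a b -> e <> 0 -> radical b.
Proof.
move=> lU r n0 g; have [[u [_ u2]]|//] := local_iso lU (b \oc g).
case: n0; rewrite -(pull1 e) -u2 -compA pull_comp (realizes_pull_r r).
exact: pull0.
Qed.

(** Built over the local summands of D: those in the e-free part go into [v], on which classes of
    E_e vanish; the others have nonsplit generating triangles, whose second maps are radical and go
    into [j]. *)
Lemma radical_resolution (D : E) : W D ->
  exists (P B : E) (e : Ext (ext E) D P) (a : hom P B) (b j v : hom B D),
  [/\ realizes e a b /\ wclass W e, W B, b = j + v, radical j &
    forall (Y : E) (z : Ext (ext E) D Y), killed z -> pull v z = 0].
Proof.
move=> WD; have [n [Y [lY hY]]] := KS D.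
elim: n Y lY D WD hY => [|n IHn] Y lY D WD hY.
  have zD : is_zero D.
    by apply/is_zeroP; have [i [p [_ _ <-]]] := hY; rewrite big_ord0.
  exists D, D, 0, 0, (idm D), 0, 0; split=> //.
  - split; first exact: zero_triangle_l.
    by move=> V WV t; apply: push0.
  - by rewrite addr0; apply/is_zeroP.
  - exact: radical0.
  - by move=> X z _; apply: pull_zero.
have [R [S [hR eS]]] := dsum_split ord0 hY; case: D / eS WD hY => WS hY.
have WY : W (Y ord0) by apply: (hl_summands hW) WS; apply: dsum_summand hY.
have WR : W R.
  apply: (hl_summands hW) WS; exists (Y ord0), (bp_swap S), (idm S).
  exact: is_iso_id.
have [PR [BR [eR [aR [bR [jR [vR [[rR wR] WBR eqR radR kR]]]]]]]] :=
  IHn _ (fun l => lY (lift ord0 l)) R WR hR.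
have [P0 [B0 [e0 [a0 [b0 [j0 [v0 [[r0 w0] WB0 eq0 rad0 k0]]]]]]]] :
  exists (P B : E) (e : Ext (ext E) (Y ord0) P) (a : hom P B)
    (b j v : hom B (Y ord0)),
  [/\ realizes e a b /\ wclass W e, W B, b = j + v, radical j &
    forall (X : E) (z : Ext (ext E) (Y ord0) X), killed z -> pull v z = 0].
  have [fY|[A [d [wd nd]]]] := local_dichotomy WY.
    (* An e-free summand is resolved by the trivial triangle 0 -> Y -> Y. *)
    have [Z zZ] := has_zero E.
    exists Z, (Y ord0), 0, 0, (idm _), 0, (idm _); split=> //.
    - split; first exact: zero_triangle_l.
      by move=> V WV t; apply: push0.
    - by rewrite add0r.
    - exact: radical0.
    - move=> X z /rel_predP h; apply: h.
      exact: e_free_complement.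
  have [P [k [e [[we [B [a [b [r WB]]]]] ke]]]] :=
    generating_exists KS hW nm ne WY wd.
  exists P, B, e, a, b, b, 0; split=> //; first by rewrite addr0.
    apply: (nonsplit_radical (lY ord0) r) => e0; apply: nd.
    by rewrite -ke e0 push0.
  by move=> X z _; apply: pull_zero.
have [SP] := has_biprod P0 PR; have [SB] := has_biprod B0 BR.
exists SP, SB, (ext_sum SP S e0 eR), (bp_map SP SB a0 aR), (bp_map SB S b0 bR),
  (bp_map SB S j0 jR), (bp_map SB S v0 vR); split.
- split; first exact: realizes_sum.
  move=> V WV t; rewrite /ext_sum pushD -!push_comp !push_pull.
  by rewrite w0 // wR // !pull0 addr0.
- exact: (hl_sums hW).
- by rewrite /bp_map eq0 eqR !compDr !compDl addrACA.
- by apply: radicalD; apply: radical_compr; apply: radical_compl.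
- move=> X z kz; rewrite /bp_map pull_add !pull_comp.
  have hz T (f : hom T S) : killed (pull f z) := rel_pullP f (RelExt kz).
  by rewrite k0 // kR // !pull0 addr0.
Qed.

Lemma e_rigid (X Y : E) (z : Ext (ext E) X Y) : W X -> W Y -> killed z -> z = 0.
Proof.
move=> WX WY kz; have [n [L [lL hL]]] := KS X.
have [i [p [_ _ ip]]] := hL.
apply: (dsum_pull0 ip) => k.
have WU : W (L k) by apply: (hl_summands hW) WX; apply: dsum_summand hL.
have lU := lL k; have kU : killed (pull (i k) z) := rel_pullP (i k) (RelExt kz).
move: (L k) (i k) WU lU kU => U g.
move: (pull g z) => {z kz p ip n L lL hL i k g} z WU lU kz.
have [fU|[A [d [wd nd]]]] := local_dichotomy WU.
  by rewrite -(pull1 z); move/rel_predP: kz; apply; apply: e_free_complement.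
(* Splice a terminal generating class over U with a resolution of its middle term: ET4op gives M ->
   B1 -> U with a class [d''] inducing [e] along [w]. *)
have [P [e [[we [B [a [b [r WB]]]]] _ maxP]]] :=
  terminal_generating lU WU wd nd.
have [P1 [B1 [e' [x1 [b' [j [v [[r' we'] WB1 eb' radj kv]]]]]]]] :=
  radical_resolution WB.
have [M [h' [u [w [d'' [[hu bh] rM ud' wd'' ud'']]]]]] := realizes_ET4op r' r.
have wcd : wclass W d''.
  move=> V WV t; apply: (wclass_pull0_inj r we WV).
  by rewrite -push_pull -ud'' -push_comp we'.
(* [d''] is generating and dominates [e], so terminality applies. Consequently [u : P1 -> M], killed
   by [w], is null and extends over [x1]. *)
have mw : mmono W w.
  apply: (maxP _ d'') => //; split=> //; exists B1, h', (b \oc b').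
  by split.
have [|y [yx _]] := monic_nul ((wclass_monic W r').1 we') (f := u).
  by apply: mw; rewrite (realizes_comp0 ud'); apply: (nul0 hA).
have [|t et] := realizes_coexact (f := h' \oc y - idm B1) r'.
  by rewrite compBl comp1m -compA yx hu subrr.
(* By the choice of [t] one has [h' y = 1 + t b'], and [b b' h' = 0] in the spliced triangle. *)
have key : b \oc (idm B + b' \oc t) \oc b' = 0.
  transitivity (b \oc b' \oc (h' \oc y)).
    rewrite compDr compm1 compDl -!compA et -compDr.
    by rewrite compBr compm1 addrC subrK.
  by rewrite compA (realizes_comp0 rM) comp0m.
have kb : killed (pull b z) := rel_pullP b (RelExt kz).
apply: (wclass_pull0_inj r we WY).
have [k [_ jk]] : is_iso (idm B + j \oc t).
  by have := radj (- t); rewrite compNr opprK.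
rewrite -(pull1 (pull b z)) -jk pull_comp.
suff -> : pull (idm B + j \oc t) (pull b z) = 0 by apply: pull0.
(* The part [v] of [b'] kills [pull b z], so only the radical part [j] remains, and [1 + j t] is
   invertible. *)
have <- : pull (idm B + b' \oc t) (pull b z) =
    pull (idm B + j \oc t) (pull b z).
  rewrite eb' compDl addrA [LHS]pull_add [X in _ + X]pull_comp kv //.
  by rewrite pull0 addr0.
apply: (wclass_pull0_inj r' we' WY).
by rewrite -!pull_comp compA key pull_zero.
Qed.

End AbelianQuotientLocal.

(** * Approximation triangles in the relative structure *)

Section RelativeHereditary.
Variables (E : extriCat) (W : E -> Prop).
Hypotheses (KS : krull_schmidt E) (hW : hereditary_like W).
Implicit Types A B C U V X Y Z : E.

(** A nonzero restriction to a local summand would have a left minimal, W-monic first map, placing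
    that summand in [e_part]. *)
Lemma wclass_e_free V A (d : Ext (ext E) V A) :
  e_free W V -> wclass W d -> d = 0.
Proof.
move=> [WV fV] wd; have [n [U [lU hU]]] := KS V; have [i [p [_ _ ip]]] := hU.
apply: (dsum_pull0 ip) => k; apply: contrapT => nk.
apply: (local_not_zero (lU k)); apply: fV (dsum_summand k hU) _.
split; first exact: (hl_summands hW) (dsum_summand k hU) WV.
have [B [a [b [r _]]]] := realizes_class (pull (i k) d).
exists A, B, a, b; split; first by exists (pull (i k) d).
  exact: left_minimal_local (lU k) r nk.
exact/(wclass_monic W r)/wclass_pull.
Qed.

Lemma wclass_killed C A (d : Ext (ext E) C A) :
  wclass W d -> rel_pred (e_complement W) d.
Proof.
move=> wd; apply/rel_predP => M [n [Y [Z [fY [i [p [_ _ ip]]]]]]].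
move=> [X [S [f [g [gf fg]]]]] h.
have e0 : pull (h \oc bp_prl S \oc g) d = 0.
  apply: (dsum_pull0 ip) => k; apply: wclass_e_free (fY k) _.
  by apply: wclass_pull; apply: wclass_pull.
have -> : h = h \oc bp_prl S \oc g \oc (f \oc bp_inl S).
  by rewrite -!compA (compA g) gf comp1m bp_ll compm1.
by rewrite pull_comp e0 pull0.
Qed.

Lemma e_complement_sub X : e_complement W X -> W X.
Proof.
move=> [n [Y [Z [fY dZ sX]]]]; apply: (hl_summands hW) sX _.
have [A _] := hl_proper hW; have [W1 [_ [_ [_ [_ WW1 _ _]]]]] := hl_left hW A.
apply: (closed_dsum (hl_sums hW) (hl_summands hW) _ dZ); first by exists W1.
by move=> k; case: (fY k).
Qed.

(** The original triangles serve again: left ones lie in E_e by [wclass_killed], right ones because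
    their W-epic second map is epic for the smaller [e_complement]. *)
Lemma relative_hereditary_like : @hereditary_like (relative_e W) W.
Proof.
case: (hW) => h1 h2 h3 h4 h5; split=> // A.
  have [W1 [W2 [w [p [[d r] WW1 WW2 [_ mw]]]]]] := h4 A.
  exists W1, W2, w, p; split=> //.
  have kd := wclass_killed ((wclass_monic W r).2 mw).
  by exists (RelExt kd).
have [W2 [W1 [i [w [[d r] WW1 WW2 [_ ew]]]]]] := h5 A.
exists W2, W1, i, w; split=> //.
have kd : rel_pred (e_complement W) d.
  apply/asboolP; exists W1, i, w; split=> // M /e_complement_sub; exact: ew.
by exists (RelExt kd).
Qed.

End RelativeHereditary.

Theorem theorem1p3 (E : extriCat) (W : E -> Prop)
    (hKS : krull_schmidt E) (hW : hereditary_like W)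
    (hlf : left_locally_finite
             (ideal_quotient (hereditary_like_additive hW))) :
  abelian (ideal_quotient (hereditary_like_additive hW)) <->
  @cluster_tilting (relative_e W) W.
Proof.
(* The relative category has the same underlying additive category, hence the same quotient by [W],
   so rigidity for E_e alone gives abelianness. *)
split=> [hab|]; last exact: (@rigid_abelian (relative_e W)).
split; first exact: relative_hereditary_like.
move=> X Y WX WY d; apply: val_inj.
exact: (e_rigid hKS hab hlf WX WY (rel_valP d)).
Qed.
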